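(* There are constants $K,\delta>0$ such that for every $0<\epsilon<\delta$, every finite-dimensional C*-algebra $F$, every C*-algebra $A$, and every $\epsilon$-$^*$-homomorphism $\phi\colon F\to A$, there exists a $^*$-homomorphism $\psi\colon F\to A$ with $$\|\psi-\phi\|<K\epsilon^{1/2}.$$ Consequently, the pair $(\mathcal F,\mathcal C^* )$ is Ulam stable, where $\mathcal F$ is the class of finite-dimensional C*-algebras and $\mathcal C^*$ is the class of all C*-algebras.
   Context: For a C*-algebra $A$, $A_{\le 1}$ denotes the closed unit ball $\{x\in A:\|x\|\le 1\}$, and $\mathbb{C}_{\le 1}=\{\lambda\in\mathbb{C}:|\lambda|\le 1\}$. For $\epsilon>0$, a map $\phi\colon A\to B$ between C*-algebras (not assumed linear or continuous) is called an $\epsilon$-$^*$-homomorphism if for all $x,y\in A_{\le 1}$ and $\lambda\in\mathbb{C}_{\le 1}$: $\|\phi(x+y)-\phi(x)-\phi(y)\|\le\epsilon$, $\|\phi(\lambda x)-\lambda\phi(x)\|\le\epsilon$, $\|\phi(xy)-\phi(x)\phi(y)\|\le\epsilon$, $\|\phi(x^* )-\phi(x)^*\|\le\epsilon$, and $\|\phi(x)\|\le 1+\epsilon$. For any map $\phi\colon A\to B$ between C*-algebras, $\|\phi\|=\sup\{\|\phi(x)\|: x\in A_{\le 1}\}$. Given classes $\mathcal C_1,\mathcal C_2$ of C*-algebras, the pair $(\mathcal C_1,\mathcal C_2)$ is Ulam stable if for every $\epsilon>0$ there is $\delta>0$ such that for all $A\in\mathcal C_1$, $B\in\mathcal C_2$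 and every $\delta$-$^*$-homomorphism $\phi\colon A\to B$ there is a $^*$-homomorphism $\psi\colon A\to B$ with $\|\phi-\psi\|<\epsilon$. *)

(* Defs.v *)
From HB Require Import structures.
From mathcomp Require Import all_boot all_order all_algebra complex.
From mathcomp Require Import boolp classical_sets reals constructive_ereal ereal.
From mathcomp Require Import topology normedtype.

Set Implicit Arguments.
Unset Strict Implicit.
Unset Printing Implicit Defensive.

Import Order.TTheory GRing.Theory Num.Theory.
Import numFieldNormedType.Exports.

Local Open Scope classical_set_scope.
Local Open Scope ring_scope.
Local Open Scope complex_scope.

Reserved Notation "x ** y" (at level 40, left associativity).

(* C*-algebras need not be unital, whereas the ring structures of the library
   are; hence multiplication is a separate operation.  The norm [`|x|] of a
   normed module over R[i] is itself a (nonnegative real) element of R[i]. *)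
HB.mixin Record NormedModule_hasCStar (R : realType) A
    of NormedModule R[i] A := {
  cmul : A -> A -> A;
  cstar : A -> A;
  cmulA : associative cmul;
  cmulDl : left_distributive cmul +%R;
  cmulDr : right_distributive cmul +%R;
  cscaleAl : forall (a : R[i]) (x y : A), a *: cmul x y = cmul (a *: x) y;
  cscaleAr : forall (a : R[i]) (x y : A), a *: cmul x y = cmul x (a *: y);
  cstarK : involutive cstar;
  cstarD : {morph cstar : x y / x + y};
  cstarZ : forall (a : R[i]) (x : A), cstar (a *: x) = a^* *: cstar x;
  cstarM : forall x y : A, cstar (cmul x y) = cmul (cstar y) (cstar x);
  cnormM : forall x y : A, `|cmul x y| <= `|x| * `|y|;
  cnorm_starM : forall x : A, `|cmul (cstar x) x| = `|x| ^+ 2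
}.

#[short(type="cstarAlgType")]
HB.structure Definition CStarAlgebra (R : realType) :=
  {A of CompleteNormedModule R[i] A & NormedModule_hasCStar R A}.

Notation "x ** y" := (cmul x y) : ring_scope.

Definition finite_dimensional (R : realType) (A : cstarAlgType R) : Prop :=
  exists n, inhabited (Vector.axiom n A).

Definition star_homomorphism (R : realType) (A B : cstarAlgType R)
    (f : A -> B) : Prop :=
  [/\ linear f,
      {morph f : x y / x ** y} &
      {morph f : x / cstar x}].

Definition approx_star_homomorphism (R : realType) (A B : cstarAlgType R)
    (eps : R) (f : A -> B) : Prop :=
  forall (x y : A) (a : R[i]), `|x| <= 1 -> `|y| <= 1 -> `|a| <= 1 ->
  [/\ `|f (x + y) - f x - f y| <= eps%:C,
      `|f (a *: x) - a *: f x| <= eps%:C,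
      `|f (x ** y) - f x ** f y| <= eps%:C,
      `|f (cstar x) - cstar (f x)| <= eps%:C &
      `|f x| <= 1 + eps%:C].

(* Extended-real valued, as an arbitrary map may be unbounded on the unit
   ball; [complex.Re] turns the R[i]-valued norm into a real number. *)
Definition map_norm (R : realType) (A B : cstarAlgType R) (f : A -> B) :
    \bar R :=
  ereal_sup [set (complex.Re `|f x|)%:E | x in [set x : A | `|x| <= 1]].

Definition ulam_stable (R : realType) (C1 C2 : cstarAlgType R -> Prop) : Prop :=
  forall eps : R, 0 < eps -> exists2 delta : R, 0 < delta &
  forall A B : cstarAlgType R, C1 A -> C2 B ->
  forall phi : A -> B, approx_star_homomorphism delta phi ->
  exists2 psi : A -> B, star_homomorphism psi &
    (map_norm (phi \- psi)%R < eps%:E)%E.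

(* Main.v *)
Require Import Defs.
From HB Require Import structures.
From mathcomp Require Import all_boot all_order all_algebra complex.
From mathcomp Require Import boolp classical_sets reals constructive_ereal ereal.
From mathcomp Require Import topology normedtype.
From mathcomp Require Import derive.
From mathcomp Require Import zify ring lra.

Set Implicit Arguments.
Unset Strict Implicit.
Unset Printing Implicit Defensive.

Import Order.TTheory GRing.Theory Num.Theory.
Import numFieldNormedType.Exports.

Local Open Scope classical_set_scope.
Local Open Scope ring_scope.
Local Open Scope complex_scope.

(** Let [phi : F -> A] be an [eps]-*-homomorphism with [F] finite dimensional.
    On the unitary group [U] of [F] it preserves products and adjoints up to
    [eps]. The group [U] is totally bounded, and a Lipschitz map [T] on it
    with multiplicative defect [d] can be improved in the way one shows that
    the cohomology of a compact group vanishes: the defect [D(u,v) = T(uv) -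
    T(u)T(v)] satisfies a cocycle identity, so adding to [T(u)] the average
    over [s] of [T(s^* ) D(s,u)] changes [T] by at most [2d] and leaves a
    defect of order [d^2], up to the error of the mean ([corrected_defect]).
    Taking the mean with the adjoint map costs another [d^2] only and makes
    the result compatible with adjoints. Iterating gives an exact *-preserving
    multiplicative map [pi] on [U] within a constant times [eps] of [phi]
    ([approx_rep_exact], [near_unitary_rep]). In place of the Haar measure the
    averages are taken over a finite net of [U] of least cardinality:
    translating such a net gives another one, and the marriage theorem matches
    the two along short distances, so that the average of a Lipschitz function
    hardly changes ([approximate_mean]). The iteration has to start from a
    Lipschitz map with values in a corner [qAq] that sends the unit to [q]; a
    partition of unity and Newton's iteration for projections provide it
    ([initial_rep]).

    It remains to extend [pi] to all of [F]. A projection [p] is sent to the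
    projection [psi0 p] for which [pi(e - 2p) = q - 2 psi0(p)]. Both [l |->
    pi(lp + e - p)] and [l |-> l psi0(p) + q - psi0(p)] are homomorphisms of
    the circle, they commute and are close to each other, so their quotient
    takes values in a small ball around the unit, and such a homomorphism is
    trivial ([pi_twist]). By the spectral theorem in [F], [pi] is thus
    determined by [psi0]. A real relation [sum a_i p_i = 0] means that the
    curve of products of the unitaries [c(t a_i) p_i + e - p_i], where [c(x)]
    is the point of the circle with imaginary part [x], has zero velocity at
    [e]; since [pi] is Lipschitz at [e], the image curve has zero velocity as
    well, which is the relation [sum a_i psi0(p_i) = 0]
    ([psi0_real_relation]). So [psi0] extends to a linear map [psi]; it
    coincides with [pi] on [U], and as [U] spans [F] it is a *-homomorphism
    ([linear_extension]). A selfadjoint contraction is half the sum of a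
    unitary and its adjoint, so [psi] is close to [phi] on the whole unit ball
    ([extension_close]).

    None of the constants depends on the dimension of [F], and the distance
    obtained is linear in [eps], hence below a multiple of its square root. *)

(** * Real-valued norms and moduli *)

Section RealNorm.
Variables (R : realType) (V : normedModType R[i]).
Implicit Types (x y z : V) (a : R[i]).

(** The norm as a real number, so that estimates are inequalities in the
    ordered field [R], where linear arithmetic applies. *)
Definition nrm x : R := complex.Re `|x|.

Lemma nrmE x : `|x| = (nrm x)%:C.
Proof.
rewrite /nrm; have := normr_ge0 x; case: `|x| => a b.
by rewrite lecE /= => /andP[/eqP -> _].
Qed.

Lemma nrm_ge0 x : 0 <= nrm x.
Proof. by rewrite -lecR -nrmE normr_ge0. Qed.

Lemma nrm0 : nrm 0 = 0.
Proof. by rewrite /nrm normr0. Qed.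

Lemma nrm0_eq0 x : nrm x = 0 -> x = 0.
Proof. by move=> h; apply/normr0_eq0; rewrite nrmE h. Qed.

Lemma nrmD x y : nrm (x + y) <= nrm x + nrm y.
Proof. by rewrite -lecR rmorphD /= -!nrmE ler_normD. Qed.

Lemma nrmN x : nrm (- x) = nrm x.
Proof. by rewrite /nrm normrN. Qed.

Lemma nrmB x y : nrm (x - y) <= nrm x + nrm y.
Proof. by rewrite -(nrmN y) nrmD. Qed.

Lemma nrm_distC x y : nrm (x - y) = nrm (y - x).
Proof. by rewrite -nrmN opprB. Qed.

Lemma nrm_tri z x y : nrm (x - y) <= nrm (x - z) + nrm (z - y).
Proof. by rewrite -(subrKA z) nrmD. Qed.

Definition cmod a : R := complex.Re `|a|.

Lemma cmodE a : `|a| = (cmod a)%:C.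
Proof. by case: a. Qed.

Lemma nrmZ a x : nrm (a *: x) = cmod a * nrm x.
Proof.
by apply: (@complexI R); rewrite rmorphM /= -!nrmE -cmodE normrZ.
Qed.

Lemma nrm_sum (I : Type) (r : seq I) (P : pred I) (f : I -> V) :
  nrm (\sum_(i <- r | P i) f i) <= \sum_(i <- r | P i) nrm (f i).
Proof.
elim/big_ind2: _ => //; first by rewrite nrm0.
by move=> x a y b hx hy; apply: (le_trans (nrmD _ _)); rewrite lerD.
Qed.

End RealNorm.

Section Modulus.
Variable R : realType.
Implicit Types (a b : R[i]) (x : R).

Lemma cmod_ge0 a : 0 <= cmod a.
Proof. by rewrite -lecR -cmodE normr_ge0. Qed.

Lemma cmodM a b : cmod (a * b) = cmod a * cmod b.
Proof. by apply: (@complexI R); rewrite rmorphM /= -!cmodE normrM. Qed.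

Lemma cmodD a b : cmod (a + b) <= cmod a + cmod b.
Proof. by rewrite -lecR rmorphD /= -!cmodE ler_normD. Qed.

Lemma cmodN a : cmod (- a) = cmod a.
Proof. by rewrite /cmod normrN. Qed.

Lemma cmodR x : cmod x%:C = `|x|.
Proof. by rewrite /cmod /= expr0n /= addr0 sqrtr_sqr. Qed.

Lemma cmod1 : cmod (1 : R[i]) = 1.
Proof. by rewrite /cmod normr1. Qed.

Lemma cmodi : cmod ('i%C : R[i]) = 1.
Proof. by rewrite /cmod /= expr0n /= add0r expr1n sqrtr1. Qed.

Lemma cmodJ a : cmod (Num.conj a) = cmod a.
Proof. by rewrite /cmod norm_conjC. Qed.

Lemma mulCJ a : cmod a = 1 -> a * Num.conj a = 1.
Proof. by move=> a1; rewrite -normCK cmodE a1 expr1n. Qed.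

Lemma conjR x : Num.conj x%:C = x%:C :> R[i].
Proof. by rewrite conj_Creal // complex_real. Qed.

Lemma cmod_nat n : cmod (n%:R : R[i]) = n%:R.
Proof. by rewrite -(rmorph_nat (real_complex R)) cmodR ger0_norm. Qed.

Lemma cmod_half : cmod (2^-1 : R[i]) = 2^-1.
Proof.
rewrite -(rmorph_nat (real_complex R)) -fmorphV cmodR.
by rewrite ger0_norm ?invr_ge0.
Qed.

Lemma conj_half : Num.conj (2^-1 : R[i]) = 2^-1.
Proof. by rewrite fmorphV rmorph_nat. Qed.

Lemma conji : Num.conj 'i%C = - 'i%C :> R[i].
Proof. by apply/eqP; rewrite eq_complex /= oppr0 !eqxx. Qed.

End Modulus.

Section Limits.
Variables (R : realType) (V : completeNormedModType R[i]).

(** Completeness in quantitative form: [b] is a common modulus for the Cauchy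
    property and for the convergence. *)
Lemma nrm_complete (x : nat -> V) (b : nat -> R) :
  (forall e, 0 < e -> exists n, b n < e) ->
  (forall n m, (n <= m)%N -> nrm (x m - x n) <= b n) ->
  exists l, forall n, nrm (x n - l) <= b n.
Proof.
move=> b0 xb.
have cx : cauchy (x @ \oo).
  apply: cauchy_exP => e e0.
  have eE : e = (complex.Re e)%:C.
    by move: e0; case: e => a c; rewrite ltcE /= => /andP[/eqP -> _].
  have [n bn] : exists n, b n < complex.Re e.
    by apply: b0; move: e0; rewrite eE ltcR.
  exists (x n); exists n => // m /= nm.
  rewrite -ball_normE /ball_ /= nrmE eE ltcR nrm_distC.
  exact: le_lt_trans (xb _ _ nm) bn.
have /cauchy_cvgP xl := cx.
exists (lim (x @ \oo)) => n.
apply/ler_addgt0Pr => e e0.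
have ec : 0 < e%:C :> R[i] by rewrite ltcR.
have /cvgrPdist_lt /(_ _ ec) [N _ HN] := xl.
pose m := maxn n N.
have h1 := xb n m (leq_maxl _ _).
have h2 : nrm (lim (x @ \oo) - x m) < e.
  by rewrite -ltcR -nrmE; apply: HN; rewrite /= leq_maxr.
apply: (le_trans (nrm_tri (x m) _ _)).
by apply: lerD; rewrite nrm_distC // ltW.
Qed.

End Limits.

(** * Elementary identities in a C*-algebra *)

Section CStarBasics.
Variables (R : realType) (A : cstarAlgType R).
Implicit Types (x y z : A) (a : R[i]).

Lemma cmul0x x : 0 ** x = 0.
Proof. by apply: (addIr (0 ** x)); rewrite -cmulDl !add0r. Qed.

Lemma cmulx0 x : x ** 0 = 0.
Proof. by apply: (addIr (x ** 0)); rewrite -cmulDr !add0r. Qed.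

Lemma cmulNl x y : (- x) ** y = - (x ** y).
Proof. by rewrite -scaleN1r -cscaleAl scaleN1r. Qed.

Lemma cmulNr x y : x ** (- y) = - (x ** y).
Proof. by rewrite -[in LHS]scaleN1r -cscaleAr scaleN1r. Qed.

Lemma cmulBl x y z : (x - y) ** z = x ** z - y ** z.
Proof. by rewrite cmulDl cmulNl. Qed.

Lemma cmulBr x y z : x ** (y - z) = x ** y - x ** z.
Proof. by rewrite cmulDr cmulNr. Qed.

Lemma cmul_suml (I : Type) (r : seq I) (P : pred I) (f : I -> A) y :
  (\sum_(i <- r | P i) f i) ** y = \sum_(i <- r | P i) f i ** y.
Proof.
by elim/big_rec2: _ => [|i u v _ <-]; rewrite ?cmul0x // cmulDl.
Qed.

Lemma cmul_sumr (I : Type) (r : seq I) (P : pred I) (f : I -> A) y :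
  y ** (\sum_(i <- r | P i) f i) = \sum_(i <- r | P i) y ** f i.
Proof.
by elim/big_rec2: _ => [|i u v _ <-]; rewrite ?cmulx0 // cmulDr.
Qed.

Lemma cstar0 : cstar (0 : A) = 0.
Proof. by apply: (addIr (cstar 0)); rewrite -cstarD !add0r. Qed.

Lemma cstarN x : cstar (- x) = - cstar x.
Proof. by rewrite -scaleN1r cstarZ -[in RHS]scaleN1r rmorphN1. Qed.

Lemma cstarB x y : cstar (x - y) = cstar x - cstar y.
Proof. by rewrite cstarD cstarN. Qed.

Lemma cstar_sum (I : Type) (r : seq I) (P : pred I) (f : I -> A) :
  cstar (\sum_(i <- r | P i) f i) = \sum_(i <- r | P i) cstar (f i).
Proof.
by elim/big_rec2: _ => [|i u v _ <-]; rewrite ?cstar0 // cstarD.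
Qed.

Lemma nrmM x y : nrm (x ** y) <= nrm x * nrm y.
Proof. by rewrite -lecR rmorphM /= -!nrmE cnormM. Qed.

Lemma nrm_starM x : nrm (cstar x ** x) = nrm x ^+ 2.
Proof. by apply: (@complexI R); rewrite rmorphXn /= -!nrmE cnorm_starM. Qed.

(** From [|y|^2 = |y^* y| <= |y^*| |y|], applied to [y] and to [y^*]. *)
Lemma nrm_star x : nrm (cstar x) = nrm x.
Proof.
suff h y : nrm y <= nrm (cstar y).
  apply/eqP; rewrite eq_le h andbT; have := h (cstar x).
  by rewrite cstarK.
have [->|y0] := eqVneq (nrm y) 0; first exact: nrm_ge0.
have yp : 0 < nrm y by rewrite lt_neqAle eq_sym y0 nrm_ge0.
by rewrite -(ler_pM2r yp) -expr2 -nrm_starM nrmM.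
Qed.

Lemma cstarM_eq0 x : cstar x ** x = 0 -> x = 0.
Proof.
move=> h; apply: nrm0_eq0; have := nrm_starM x.
by rewrite h nrm0 => /esym/eqP; rewrite expf_eq0 /= => /eqP.
Qed.

Definition projection x := cstar x = x /\ x ** x = x.

Lemma projection0 : projection 0.
Proof. by split; rewrite ?cstar0 ?cmulx0. Qed.

Lemma nrm_projection x : projection x -> x != 0 -> nrm x = 1.
Proof.
move=> [xs xx] x0; have := nrm_starM x; rewrite xs xx expr2.
rewrite -[LHS]mulr1 => /esym; apply: mulfI.
by apply: contra x0 => /eqP /nrm0_eq0 ->.
Qed.

Lemma nrm_projection_le1 x : projection x -> nrm x <= 1.
Proof.
move=> px; have [->|x0] := eqVneq x 0; first by rewrite nrm0.
by rewrite nrm_projection.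
Qed.

End CStarBasics.

(** * Normalization of identities in an algebra without unit *)

(** Syntax of noncommutative polynomials, for a reflexive tactic that expands
    an identity into words in the atoms and reduces it to identities between
    scalar coefficients. *)
Inductive cexpr (K : Type) : Type :=
  | CVar of nat
  | CZero
  | CAdd of cexpr K & cexpr K
  | COpp of cexpr K
  | CMul of cexpr K & cexpr K
  | CScale of K & cexpr K.
Arguments CVar {K}.
Arguments CZero {K}.

Section NormalForm.
Variable K : Type.
Variables (one : K) (add mul : K -> K -> K) (opp : K -> K).

(** A word is given by its first letter and its remaining letters: there is no
    empty word since the algebra has no unit. *)
Definition word := (nat * seq nat)%type.

Fixpoint map_coef (f : K -> K) (l : seq (K * word)) : seq (K * word) :=
  if l is (k, w) :: l' then (f k, w) :: map_coef f l' else [::].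

Fixpoint cat_word (s t : seq nat) :=
  if s is n :: s' then n :: cat_word s' t else t.

Fixpoint cat_terms (s t : seq (K * word)) :=
  if s is n :: s' then n :: cat_terms s' t else t.

Fixpoint mul_term k n w (l : seq (K * word)) : seq (K * word) :=
  if l is (k', (n', w')) :: l' then
    (mul k k', (n, cat_word w (n' :: w'))) :: mul_term k n w l' else [::].

Fixpoint mul_terms (l1 l2 : seq (K * word)) :=
  if l1 is (k, (n, w)) :: l1' then
    cat_terms (mul_term k n w l2) (mul_terms l1' l2) else [::].

Fixpoint expand (e : cexpr K) : seq (K * word) :=
  match e with
  | CVar n => [:: (one, (n, [::]))]
  | CZero => [::]
  | CAdd e1 e2 => cat_terms (expand e1) (expand e2)
  | COpp e1 => map_coef opp (expand e1)
  | CMul e1 e2 => mul_terms (expand e1) (expand e2)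
  | CScale k e1 => map_coef (mul k) (expand e1)
  end.

(** Comparison functions and concatenations are spelled out with plain pattern
    matching, which lets [cbv] evaluate them while the operations on the
    coefficients stay folded. *)
Fixpoint eq_num (m n : nat) :=
  match m, n with
  | 0%N, 0%N => true
  | S m', S n' => eq_num m' n'
  | _, _ => false
  end.

Fixpoint eq_letters (s t : seq nat) :=
  match s, t with
  | [::], [::] => true
  | m :: s', n :: t' => if eq_num m n then eq_letters s' t' else false
  | _, _ => false
  end.

Fixpoint insert_term k n w (l : seq (K * word)) : seq (K * word) :=
  if l is (k', (n', w')) :: l' then
    if (if eq_num n n' then eq_letters w w' else false)
    then (add k k', (n, w)) :: l'
    else (k', (n', w')) :: insert_term k n w l'
  else [:: (k, (n, w))].

Fixpoint collect (l : seq (K * word)) :=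
  if l is (k, (n, w)) :: l' then insert_term k n w (collect l') else [::].

Fixpoint coefs_vanish (P : K -> Prop) (l : seq (K * word)) : Prop :=
  if l is (k, _) :: l' then P k /\ coefs_vanish P l' else True.

End NormalForm.

Section NormalFormSound.
Variables (R : realType) (A : cstarAlgType R) (env : seq A).
Local Notation K := R[i].
Local Notation terms := (seq (K * word)).

Fixpoint cexpr_eval (e : cexpr K) : A :=
  match e with
  | CVar n => nth 0 env n
  | CZero => 0
  | CAdd e1 e2 => cexpr_eval e1 + cexpr_eval e2
  | COpp e1 => - cexpr_eval e1
  | CMul e1 e2 => cexpr_eval e1 ** cexpr_eval e2
  | CScale k e1 => k *: cexpr_eval e1
  end.

Fixpoint letters_eval n (w : seq nat) : A :=
  if w is m :: w' then nth 0 env n ** letters_eval m w' else nth 0 env n.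

Fixpoint terms_eval (l : terms) : A :=
  if l is (k, (n, w)) :: l' then k *: letters_eval n w + terms_eval l' else 0.

Lemma letters_eval_cat n w m v :
  letters_eval n (cat_word w (m :: v)) = letters_eval n w ** letters_eval m v.
Proof. by elim: w n => [|k w IH] n //=; rewrite IH cmulA. Qed.

Lemma terms_eval_cat l1 l2 :
  terms_eval (cat_terms l1 l2) = terms_eval l1 + terms_eval l2.
Proof.
by elim: l1 => [|[k [n w]] l IH] /=; rewrite ?add0r // IH addrA.
Qed.

Lemma terms_eval_map f a l : (forall k x, f k *: x = a *: (k *: x) :> A) ->
  terms_eval (map_coef f l) = a *: terms_eval l.
Proof.
move=> fE; elim: l => [|[k [n w]] l IH] /=; first by rewrite scaler0.
by rewrite IH scalerDr fE.
Qed.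

Lemma terms_eval_mul l1 l2 :
  terms_eval (mul_terms *%R l1 l2) = terms_eval l1 ** terms_eval l2.
Proof.
elim: l1 => [|[k [n w]] l IH] /=; first by rewrite cmul0x.
rewrite terms_eval_cat IH cmulDl; congr (_ + _).
elim: l2 {IH} => [|[k' [n' w']] l2 IH] /=; first by rewrite cmulx0.
rewrite IH cmulDr letters_eval_cat; congr (_ + _).
by rewrite -cscaleAl -cscaleAr scalerA.
Qed.

Lemma expandE e :
  terms_eval (expand 1 *%R -%R e) = cexpr_eval e.
Proof.
elim: e => [n||e1 IH1 e2 IH2|e IH|e1 IH1 e2 IH2|k e IH] //=.
- by rewrite scale1r addr0.
- by rewrite terms_eval_cat IH1 IH2.
- rewrite (@terms_eval_map _ (-1)) ?IH ?scaleN1r // => k x.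
  by rewrite scaleNr scaleN1r.
- by rewrite terms_eval_mul IH1 IH2.
- by rewrite (@terms_eval_map _ k) ?IH // => k' x; rewrite scalerA.
Qed.

Lemma eq_numP m n : eq_num m n -> m = n.
Proof. by elim: m n => [|m IH] [|n] //= /IH ->. Qed.

Lemma eq_lettersP s t : eq_letters s t -> s = t.
Proof.
elim: s t => [|m s IH] [|n t] //=.
by case: ifP => // /eq_numP -> /IH ->.
Qed.

Lemma insert_termE k n w l :
  terms_eval (insert_term +%R k n w l) = k *: letters_eval n w + terms_eval l.
Proof.
elim: l => [|[k' [n' w']] l IH] //=.
case: ifP => [|_ /=]; last by rewrite IH addrCA.
by case: ifP => // /eq_numP -> /eq_lettersP -> /=; rewrite scalerDl addrA.
Qed.

Lemma collectE l : terms_eval (collect +%R l) = terms_eval l.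
Proof. by elim: l => [|[k [n w]] l IH] //=; rewrite insert_termE IH. Qed.

(** Soundness: two expressions have the same value as soon as every collected
    coefficient of their difference vanishes. *)
Lemma cexpr_eq e1 e2 :
  coefs_vanish (eq^~ 0)
    (collect +%R (expand 1 *%R -%R (CAdd e1 (COpp e2)))) ->
  cexpr_eval e1 = cexpr_eval e2.
Proof.
move=> h; apply/eqP; rewrite -subr_eq0; apply/eqP.
have -> : cexpr_eval e1 - cexpr_eval e2 = cexpr_eval (CAdd e1 (COpp e2)) by [].
rewrite -expandE -collectE; elim: (collect _ _) h => [|[k [n w]] l IH] //=.
by move=> [-> /IH ->]; rewrite scale0r addr0.
Qed.

End NormalFormSound.

Ltac calg_mem a l :=
  match l with
  | nil => false
  | cons a _ => true
  | cons _ ?l' => calg_mem a l'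
  end.

Ltac calg_atoms x l :=
  lazymatch x with
  | ?a + ?b => let l1 := calg_atoms a l in calg_atoms b l1
  | - ?a => calg_atoms a l
  | ?a ** ?b => let l1 := calg_atoms a l in calg_atoms b l1
  | ?k *: ?a => calg_atoms a l
  | 0 => l
  | _ => let b := calg_mem x l in
         match b with true => l | false => constr:(cons x l) end
  end.

Ltac calg_index a l :=
  lazymatch l with
  | cons a _ => constr:(O)
  | cons _ ?l' => let n := calg_index a l' in constr:(S n)
  end.

Ltac calg_quote K x l :=
  lazymatch x with
  | ?a + ?b => let ea := calg_quote K a l in let eb := calg_quote K b l in
               constr:(CAdd ea eb)
  | - ?a => let ea := calg_quote K a l in constr:(COpp ea)
  | ?a ** ?b => let ea := calg_quote K a l in let eb := calg_quote K b l in
               constr:(CMul ea eb)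
  | ?k *: ?a => let ea := calg_quote K a l in constr:(CScale (k : K) ea)
  | 0 => constr:(@CZero K)
  | _ => let n := calg_index x l in constr:(@CVar K n)
  end.

(** Leaves one equation between scalars for each word that occurs; [calg]
    closes them with [ring]. *)
Ltac calg_raw :=
  match goal with
  | |- @eq ?T ?x ?y =>
    match T with context [?A] =>
    match type of A with CStarAlgebra.type ?R =>
    let l0 := calg_atoms x (@nil (CStarAlgebra.sort A)) in
    let l := calg_atoms y l0 in
    let e1 := calg_quote (complex (Real.sort R)) x l in
    let e2 := calg_quote (complex (Real.sort R)) y l in
    refine (@cexpr_eq R A l e1 e2 _);
    cbv [coefs_vanish collect insert_term expand map_coef cat_terms mul_terms
         mul_term cat_word eq_num eq_letters]
    end end
  end.
Ltac calg := calg_raw; repeat split; ring.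

(** * The unitization as an algebra with unit *)

Section Unitization.
Variables (R : realType) (A : cstarAlgType R).

(** Taken as an algebra, without norm or involution, [A + C 1] makes
    polynomials in an element of [A] available through [horner_alg]. Those
    without constant term take their values in [A]. *)
Definition unitization : Type := (A * R[i]^o)%type.
HB.instance Definition _ := GRing.Lmodule.on unitization.
Implicit Types x y z : unitization.

Definition unit_mul x y : unitization :=
  (x.1 ** y.1 + x.2 *: y.1 + y.2 *: x.1, x.2 * y.2).
Definition unit_one : unitization := (0, 1).

Lemma unitization_eq x y : x.1 = y.1 -> x.2 = y.2 -> x = y.
Proof. by case: x y => [a b] [c d] /= -> ->. Qed.

Fact unit_mulA : associative unit_mul.
Proof. by move=> x y z; apply: unitization_eq => /=; [calg | exact: mulrA]. Qed.

Fact unit_mul1x : left_id unit_one unit_mul.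
Proof. by move=> x; apply: unitization_eq => /=; [calg | exact: mul1r]. Qed.

Fact unit_mulx1 : right_id unit_one unit_mul.
Proof. by move=> x; apply: unitization_eq => /=; [calg | exact: mulr1]. Qed.

Fact unit_mulDl : left_distributive unit_mul +%R.
Proof. by move=> x y z; apply: unitization_eq => /=; [calg | exact: mulrDl]. Qed.

Fact unit_mulDr : right_distributive unit_mul +%R.
Proof. by move=> x y z; apply: unitization_eq => /=; [calg | exact: mulrDr]. Qed.

Fact unit_1neq0 : unit_one != 0.
Proof. by apply/eqP => -[] /eqP; rewrite oner_eq0. Qed.

HB.instance Definition _ := GRing.Zmodule_isNzRing.Build unitization
  unit_mulA unit_mul1x unit_mulx1 unit_mulDl unit_mulDr unit_1neq0.

Fact unit_scaleAl (a : R[i]) x y : a *: (x * y) = (a *: x) * y.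
Proof.
by apply: unitization_eq => /=; [rewrite -[a *: x.2]/(a * x.2); calg | exact: mulrA].
Qed.

HB.instance Definition _ :=
  GRing.Lmodule_isLalgebra.Build R[i] unitization unit_scaleAl.

Fact unit_scaleAr (a : R[i]) x y : a *: (x * y) = x * (a *: y).
Proof.
by apply: unitization_eq => /=; [rewrite -[a *: y.2]/(a * y.2); calg | exact: mulrCA].
Qed.

HB.instance Definition _ :=
  GRing.Lalgebra_isAlgebra.Build R[i] unitization unit_scaleAr.

Definition inu (x : A) : unitization := (x, 0).

Lemma inuM (x y : A) : inu (x ** y) = inu x * inu y.
Proof. by apply: unitization_eq => /=; rewrite ?mulr0 // !scale0r !addr0. Qed.

Lemma horner_inu2 (x : A) (p : {poly R[i]}) :
  (horner_alg (inu x) p).2 = p.[0].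
Proof.
elim/poly_ind: p => [|p c IH]; first by rewrite rmorph0 horner0.
rewrite rmorphD rmorphM /= horner_algX horner_algC hornerMXaddC.
by rewrite mulr0 add0r /= mulr0 add0r [RHS]/= /GRing.scale /= mulr1.
Qed.

Lemma comm_horner_alg (x y : unitization) (p : {poly R[i]}) :
  x * y = y * x -> horner_alg x p * y = y * horner_alg x p.
Proof.
move=> xy; elim/poly_ind: p => [|p c IH]; first by rewrite rmorph0 mul0r mulr0.
rewrite rmorphD rmorphM /= horner_algX horner_algC mulrDl mulrDr.
by rewrite -mulrA xy !mulrA IH -scalerAl mul1r -scalerAr mulr1.
Qed.

End Unitization.

(** * The spectral theorem in finite dimension *)

Section Normal.
Variables (R : realType) (A : cstarAlgType R).
Implicit Types (x y : A).

Definition normal x := x ** cstar x = cstar x ** x.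

Lemma comm_mulACA x y : x ** y = y ** x ->
  (y ** x) ** (y ** x) = (y ** y) ** (x ** x).
Proof. by move=> xy; rewrite -cmulA (cmulA x) xy -cmulA cmulA. Qed.

Lemma comm_sqr x y : x ** y = y ** x ->
  (x ** x) ** (y ** y) = (y ** y) ** (x ** x).
Proof.
move=> xy; rewrite -(comm_mulACA xy).
by rewrite -cmulA (cmulA x y) xy -(cmulA y x) xy (cmulA x y) xy.
Qed.

Lemma normal_sqr x : normal x -> normal (x ** x).
Proof. by move=> nx; rewrite /normal cstarM; exact: comm_sqr. Qed.

(** By the C*-identity used twice: [x^* x] is selfadjoint, and its square [x^*
    x^* x x] vanishes. *)
Lemma normal_sqr0 x : normal x -> x ** x = 0 -> x = 0.
Proof.
move=> nx xx; apply: cstarM_eq0; apply: cstarM_eq0.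
by rewrite cstarM cstarK comm_mulACA // xx cmulx0.
Qed.

(** With [x] and [x^*] commuting, [(x^* x - x)^* (x^* x - x)] expands to [0],
    hence [x = x^* x]. *)
Lemma normal_idempotent x : normal x -> x ** x = x -> projection x.
Proof.
move=> nx xx.
have xxs : cstar x ** cstar x = cstar x by rewrite -cstarM xx.
suff h : cstar x ** x - x = 0.
  have xE : cstar x ** x = x by apply/eqP; rewrite -subr_eq0 h.
  by split=> //; rewrite -[in LHS]xE cstarM cstarK.
apply: cstarM_eq0; rewrite cstarB cstarM cstarK cmulBl !cmulBr.
rewrite comm_mulACA // xx xxs -cmulA xx cmulA xxs.
by rewrite !subrr.
Qed.

End Normal.

Section Spectral.
Variables (R : realType) (F : cstarAlgType R) (n : nat).
Hypothesis vF : inhabited (Vector.axiom n F).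
Implicit Types (x y a : F).
Local Notation C := R[i].

(** The powers [a, ..., a^(n+1)] are linearly dependent in dimension [n]; the
    factor ['X] records that the relation has no constant term. *)
Lemma annihilating_poly a : exists2 p : {poly C}, p != 0 /\ (size p <= n.+1)%N &
  horner_alg (inu a) ('X * p) = 0.
Proof.
case: vF => -[f linf [g fK gK]].
pose pw k := (inu a ^+ k.+1).1.
have pwE k : inu a ^+ k.+1 = inu (pw k).
  apply: unitization_eq => //=; rewrite /pw; elim: k => // k IH.
  by rewrite exprS /= mul0r.
pose M := \matrix_(k < n.+1) f (pw k).
have kM : kermx M != 0.
  rewrite -mxrank_eq0 mxrank_ker subn_eq0 -ltnNge ltnS.
  exact: rank_leq_col.
pose c := nz_row (kermx M).
have c0 : c != 0 by rewrite nz_row_eq0.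
have cM : c *m M = 0 by apply/sub_kermxP; exact: nz_row_sub.
pose fl : {linear F -> 'rV[C]_n} := HB.pack f
  (GRing.isLinear.Build _ _ _ _ f linf).
have sc : \sum_(k < n.+1) c 0 k *: pw k = 0.
  apply: (can_inj fK); change (fl (\sum_(k < n.+1) c 0 k *: pw k) = fl 0).
  rewrite linear_sum linear0 -[RHS]cM; apply/rowP => j.
  rewrite summxE !mxE; apply: eq_bigr => k _.
  by rewrite linearZ !mxE.
exists (\poly_(k < n.+1) c 0 (inord k)).
  split; last exact: size_poly.
  apply: contra c0 => /eqP h; apply/eqP/rowP => k.
  have := congr1 (fun q : {poly C} => q`_k) h.
  by rewrite coef_poly coef0 ltn_ord inord_val mxE.
rewrite rmorphM /= horner_algX poly_def linear_sum /= mulr_sumr.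
transitivity (inu (\sum_(k < n.+1) c 0 k *: pw k)); last by rewrite sc.
transitivity (\sum_(k < n.+1) inu (c 0 k *: pw k)).
  apply: eq_bigr => k _; rewrite inord_val linearZ /= rmorphXn /= horner_algX.
  rewrite mulr_algl -scalerAr -exprS pwE; apply: unitization_eq => //=.
  exact: mulr0.
elim/big_rec2: _ => [|i u v _ ->]; first by apply: unitization_eq.
by apply: unitization_eq => //=; rewrite addr0.
Qed.

(** Raising the exponent to a power of two reduces the claim to repeated use
    of [normal_sqr0]. *)
Lemma inu_normal_nilpotent a m : normal a -> inu a ^+ m.+1 = 0 -> a = 0.
Proof.
move=> na am; suff h k : inu a ^+ (2 ^ k) = 0 -> a = 0.
  have hm : (m.+1 <= 2 ^ m.+1)%N by apply: ltnW; apply: ltn_expl.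
  by apply: (h m.+1); rewrite -(subnK hm) exprD am mulr0.
elim: k a na {am} => [|k IH] x nx; first by rewrite expr1 => -[].
rewrite expnS exprM expr2 -inuM => /IH h; apply: normal_sqr0 => //.
by apply: h; apply: normal_sqr.
Qed.

(** What commutes with [a] commutes with a polynomial [b] in [a]; applied to
    [a^*], and then after taking adjoints to [b^*], this shows that [b] is
    normal. *)
Lemma normal_horner a (p : {poly C}) : normal a -> p.[0] = 0 ->
  exists2 b, horner_alg (inu a) p = inu b & normal b.
Proof.
move=> na p0; pose b := (horner_alg (inu a) p).1.
have pb : horner_alg (inu a) p = inu b.
  by apply: unitization_eq => //=; rewrite horner_inu2.
exists b => //.
have comm_b y : a ** y = y ** a -> b ** y = y ** b.
  move=> ay; have := @comm_horner_alg R F (inu a) (inu y) p.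
  by rewrite -!inuM ay pb -!inuM => /(_ erefl) [].
have /(congr1 cstar) := comm_b _ na.
by rewrite !cstarM cstarK => /comm_b.
Qed.

(** The list consists of the distinct nonzero roots of an annihilating
    polynomial [P]. A polynomial [q] that vanishes there and at [0] has a
    power divisible by [P], so [q(a)] is nilpotent and normal, hence zero. *)
Lemma spectrum_exists a : normal a -> exists rs : seq C,
  [/\ uniq rs, 0 \notin rs, (size rs <= n)%N &
    forall q : {poly C}, q.[0] = 0 -> {in rs, forall z, q.[z] = 0} ->
      horner_alg (inu a) q = 0].
Proof.
move=> na; have [p [p0 sp] pa] := annihilating_poly a.
have [r pE] := closed_field_poly_normal p.
have lp : lead_coef p != 0 by rewrite lead_coef_eq0.
have sr : (size r <= n)%N.
  by move: sp; rewrite pE size_scale // size_prod_XsubC.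
exists [seq z <- undup r | z != 0]; split.
- by rewrite filter_uniq ?undup_uniq.
- by rewrite mem_filter eqxx.
- rewrite size_filter; apply: leq_trans (count_size _ _) _.
  exact: leq_trans (size_undup _) sr.
move=> q q0 qr; have [b qb nb] := normal_horner na q0.
rewrite qb (@inu_normal_nilpotent b (size r)) //.
have rq z : z \in r -> ('X - z%:P) %| q.
  rewrite dvdp_XsubCl /root => zr; have [->|z0] := eqVneq z 0.
    by rewrite q0.
  by rewrite qr // mem_filter z0 mem_undup.
have : \prod_(z <- r) ('X - z%:P) %| q ^+ size r.
  elim: r rq {pE sr qr} => [|z r IH] rq; first by rewrite big_nil dvd1p.
  rewrite big_cons exprS dvdp_mul ?rq ?mem_head // IH // => w wr.
  by apply: rq; rewrite inE wr orbT.
have Xq : 'X %| q by rewrite -[X in X %| _]subr0 dvdp_XsubCl /root q0.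
move=> /(dvdp_mul Xq) /dvdpP [w]; rewrite -exprS => qE.
rewrite -qb -rmorphXn qE rmorphM /=.
suff -> : horner_alg (inu a) ('X * \prod_(z <- r) ('X - z%:P)) = 0.
  by rewrite mulr0.
move: pa; rewrite pE -scalerAr linearZ /= => pa.
apply/eqP; apply: contraT => h.
have := congr1 ( *:%R (lead_coef p)^-1) pa.
by rewrite mulr_algl scalerA mulVf // scale1r scaler0 => /eqP; rewrite (negbTE h).
Qed.

(** The projections are the values at [a] of the Lagrange interpolation
    polynomials of the spectrum that vanish at [0]. The bound on their number
    makes estimates uniform over all normal elements. *)
Theorem spectral_decomposition a : normal a ->
  exists k (l : 'I_k -> C) (p : 'I_k -> F),
  [/\ (k <= n)%N, forall i, projection (p i) /\ p i != 0,
    forall i, l i != 0, forall i j, i != j -> p i ** p j = 0 &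
    a = \sum_(i < k) l i *: p i].
Proof.
move=> na; have [rs [urs rs0 srs kill]] := spectrum_exists na.
pose d (z : C) := z * \prod_(w <- rs | w != z) (z - w).
pose L (z : C) : {poly C} := (d z)^-1 *: ('X * \prod_(w <- rs | w != z) ('X - w%:P)).
have d0 z : z \in rs -> d z != 0.
  move=> zr; rewrite mulf_neq0 //; first by apply: contraNneq rs0 => <-.
  by rewrite prodf_seq_neq0; apply/allP => w _; rewrite subr_eq0 eq_sym; apply/implyP.
have LE z (x : C) : (L z).[x] = (d z)^-1 * (x * \prod_(w <- rs | w != z) (x - w)).
  rewrite /L hornerZ hornerM hornerX horner_prod; congr (_ * (_ * _)).
  by apply: eq_bigr => w _; rewrite hornerXsubC.
(* Without this, rewriting with the evaluation rules would unfold [L]. *)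
clearbody L.
have L0 z : (L z).[0] = 0 by rewrite LE mul0r mulr0.
have Lz z : z \in rs -> (L z).[z] = 1 by move=> zr; rewrite LE mulVf ?d0.
have Lw z w : w \in rs -> w != z -> (L z).[w] = 0.
  move=> wr wz; rewrite LE (big_rem w) //= wz subrr mul0r.
  by rewrite !mulr0.
pose P z := (horner_alg (inu a) (L z)).1.
have PE z : horner_alg (inu a) (L z) = inu (P z).
  by apply: unitization_eq => //=; rewrite horner_inu2 L0.
have Pn z : normal (P z).
  have [b bE nb] := normal_horner na (L0 z).
  by move: bE; rewrite PE => -[->].
have Pp z : z \in rs -> projection (P z).
  move=> zr; apply: normal_idempotent => //.
  suff : horner_alg (inu a) (L z * L z - L z) = 0.
    by rewrite rmorphB rmorphM /= PE -inuM => /subr0_eq [].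
  apply: kill => [|w wr]; first by rewrite !hornerE L0 mulr0 subr0.
  rewrite !hornerE; have [->|wz] := eqVneq w z; first by rewrite Lz // mulr1 subrr.
  by rewrite Lw // mulr0 subr0.
have PP z w : z \in rs -> w \in rs -> z != w -> P z ** P w = 0.
  move=> zr wr zw; suff : horner_alg (inu a) (L z * L w) = 0.
    by rewrite rmorphM /= !PE -inuM => -[].
  apply: kill => [|v vr]; first by rewrite !hornerE L0 mul0r.
  rewrite !hornerE; have [->|vz] := eqVneq v z; last by rewrite Lw // mul0r.
  by rewrite (@Lw w z) // mulr0.
have aE : a = \sum_(z <- rs) z *: P z.
  have : horner_alg (inu a) ('X - \sum_(z <- rs) z *: L z) = 0.
    apply: kill => [|v vr].
      rewrite !hornerE horner_sum big1 ?oppr0 // => z _.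
      by rewrite hornerZ L0 mulr0.
    rewrite !hornerE horner_sum (bigD1_seq v) //= hornerZ Lz // mulr1.
    rewrite big1 ?addr0 ?subrr // => z zv.
    by rewrite hornerZ Lw ?mulr0 // eq_sym.
  rewrite rmorphB /= horner_algX linear_sum /= => /subr0_eq aE.
  have := congr1 fst aE; rewrite /= => ->.
  elim/big_rec2: _ => //= z u v _ <-.
  suff -> : horner_alg (inu a) (z *: L z) = z *: inu (P z) by [].
  by rewrite linearZ /= PE mulr_algl.
pose s := [seq z <- rs | P z != 0].
have sin (i : 'I_(size s)) : s`_i \in rs /\ P s`_i != 0.
  by have := mem_nth 0 (ltn_ord i); rewrite mem_filter => /andP[-> ->].
exists (size s), (fun i => s`_i), (fun i => P s`_i); split.
- by rewrite size_filter; apply: leq_trans srs; exact: count_size.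
- by move=> i; have [si ->] := sin i; split=> //; exact: Pp.
- by move=> i; have [si _] := sin i; apply: contraNneq rs0 => <-.
- move=> i j ij; apply: PP; [by have [] := sin i | by have [] := sin j |].
  by rewrite nth_uniq // filter_uniq.
- rewrite -(big_mkord xpredT (fun i => s`_i *: P s`_i)).
  rewrite -(big_nth 0 xpredT (fun z => z *: P z)) big_filter aE.
  rewrite [LHS](bigID (fun z => P z != 0)) /= [X in _ + X]big1 ?addr0 // => z.
  by rewrite negbK => /eqP ->; rewrite scaler0.
Qed.

End Spectral.

(** * The unit of a finite-dimensional C*-algebra *)

Section Unit.
Variables (R : realType) (F : cstarAlgType R) (n : nat).
Hypothesis vF : inhabited (Vector.axiom n F).
Implicit Types (x y a p : F).
Local Notation C := R[i].

Lemma projection_sum (A : cstarAlgType R) k (p : 'I_k -> A) :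
  (forall i, projection (p i)) -> (forall i j, i != j -> p i ** p j = 0) ->
  projection (\sum_i p i).
Proof.
move=> pp porth; split.
  by rewrite cstar_sum; apply: eq_bigr => i _; have [] := pp i.
rewrite cmul_suml; apply: eq_bigr => i _; rewrite cmul_sumr (bigD1 i) //=.
have [_ ->] := pp i; rewrite big1 ?addr0 // => j ji.
by rewrite porth // eq_sym.
Qed.

Lemma orth_sum_mul (A : cstarAlgType R) k (p : 'I_k -> A) (l : 'I_k -> C) i :
  (forall i, projection (p i)) -> (forall i j, i != j -> p i ** p j = 0) ->
  p i ** (\sum_j l j *: p j) = l i *: p i.
Proof.
move=> pp porth; rewrite cmul_sumr (bigD1 i) //= big1 => [|j ji].
  by rewrite addr0 -cscaleAr; have [_ ->] := pp i.
by rewrite -cscaleAr porth ?scaler0 // eq_sym.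
Qed.

(** The sum of the spectral projections; each of them is a nonzero multiple of
    its product with [a]. *)
Lemma support_projection a : normal a ->
  exists2 r, projection r & r ** a = a /\ forall b, a ** b = 0 -> r ** b = 0.
Proof.
move=> na; have [k [l [p [_ pp l0 porth aE]]]] := spectral_decomposition vF na.
have pp' i : projection (p i) by have [] := pp i.
have pa i : p i ** a = l i *: p i by rewrite aE orth_sum_mul.
exists (\sum_i p i); first exact: projection_sum.
split=> [|b ab]; rewrite cmul_suml.
  by rewrite [RHS]aE; apply: eq_bigr => i _; rewrite pa.
rewrite big1 // => i _; rewrite -[p i]scale1r -(mulVf (l0 i)) -scalerA -pa.
by rewrite -cscaleAl -cmulA ab cmulx0 scaler0.
Qed.

(** Adding to [p] the support projection [r] of [z z^*], where [z = x - p x].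
    The product [p z] is zero, so [r] is orthogonal to [p], and [(r z - z)(r z
    - z)^*] vanishes, so [r z = z]. *)
Lemma projection_grow p x : projection p -> exists2 p', projection p' &
  p' ** x = x /\ forall w, p ** w = w -> p' ** w = w.
Proof.
move=> [ps pp]; pose z := x - p ** x; pose y := z ** cstar z.
have pz : p ** z = 0 by rewrite cmulBr cmulA pp subrr.
have ys : cstar y = y by rewrite cstarM cstarK.
have yn : normal y by rewrite /normal ys.
have [r [rs rr] [ry rb]] := support_projection yn.
have yr : y ** r = y by rewrite -ys -{1}rs -cstarM ry.
have yp : y ** p = 0 by rewrite -ys -ps -cstarM /y cmulA pz cmul0x cstar0.
have rp := rb _ yp.
have pr : p ** r = 0 by rewrite -ps -rs -cstarM rp cstar0.
have rz : r ** z = z.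
  suff /subr0_eq : r ** z - z = 0 by [].
  rewrite -[LHS]cstarK; have -> : cstar (r ** z - z) = 0; last exact: cstar0.
  apply: cstarM_eq0; rewrite cstarK cstarB cstarM rs.
  have -> : (r ** z - z) ** (cstar z ** r - cstar z) =
    (r ** y) ** r - r ** y - (y ** r - y) by rewrite /y; calg.
  by rewrite ry yr subrr.
exists (p + r).
  split; first by rewrite cstarD ps rs.
  by rewrite cmulDl !cmulDr pp rr pr rp add0r addr0.
have grow w : p ** w = w -> (p + r) ** w = w.
  by move=> pw; rewrite cmulDl pw -pw cmulA rp cmul0x addr0.
split=> //; have xE : x = p ** x + z by rewrite addrCA subrr addr0.
rewrite {1}xE cmulDr grow ?cmulA ?pp //.
by rewrite cmulDl pz rz add0r -xE.
Qed.

Definition algebra_unit (e : F) := forall x, e ** x = x /\ x ** e = x.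

(** Growing the zero projection along a basis gives a projection that is a
    left unit; taking adjoints, it is a right unit. *)
Theorem unit_exists : exists e, algebra_unit e.
Proof.
case: (vF) => -[f linf [g fK gK]].
have linear_ext p : (forall i, p ** g (delta_mx 0 i) = g (delta_mx 0 i)) ->
    forall x, p ** x = x.
  move=> pg x.
  pose fl : {linear F -> 'rV[C]_n} := HB.pack f
    (GRing.isLinear.Build _ _ _ _ f linf).
  have -> : x = \sum_i f x 0 i *: g (delta_mx 0 i).
    apply: (can_inj fK).
    change (f x = fl (\sum_i f x 0 i *: g (delta_mx 0 i))).
    rewrite linear_sum [LHS]row_sum_delta; apply: eq_bigr => i _.
    by rewrite linearZ /= gK.
  rewrite cmul_sumr; apply: eq_bigr => i _.
  by rewrite -cscaleAr pg.
have [e [es ee] eg] : exists2 e, projection e & 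
    forall i, i \in enum 'I_n -> e ** g (delta_mx 0 i) = g (delta_mx 0 i).
  elim: (enum 'I_n) => [|i s [p pp ps]]; first by exists 0 => //; exact: projection0.
  have [p' pp' [p'i p's]] := projection_grow (g (delta_mx 0 i)) pp.
  exists p' => // j; rewrite inE => /orP[/eqP -> //|/ps]; exact: p's.
have ex x : e ** x = x by apply: linear_ext => i; apply: eg; rewrite mem_enum.
exists e => x; split=> //.
by rewrite -[x in LHS]cstarK -{1}es -cstarM ex cstarK.
Qed.

End Unit.

(** * Unitaries relative to a projection *)

Section Corner.
Variables (R : realType) (A : cstarAlgType R) (e : A).
Local Notation C := R[i].

(** The element [l p + (e - p)] of the corner with unit [e]. *)
Definition twist (l : C) (p : A) : A := e + (l - 1) *: p.

Definition below p := [/\ projection p, e ** p = p & p ** e = p].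

Lemma twistM l m p : projection e -> below p ->
  twist l p ** twist m p = twist (l * m) p.
Proof.
move=> [_ ee] [[_ pp] ep pe]; rewrite /twist.
rewrite cmulDl !cmulDr -!cscaleAr -!cscaleAl ee ep pe pp.
by calg.
Qed.

Lemma twist_star l p : projection e -> projection p ->
  cstar (twist l p) = twist (Num.conj l) p.
Proof.
move=> [es _] [ps _]; rewrite /twist cstarD cstarZ es ps.
by rewrite rmorphB rmorph1.
Qed.

Lemma twist1 p : twist 1 p = e.
Proof. by rewrite /twist subrr scale0r addr0. Qed.

(** Unitaries of the corner with unit [e]. *)
Definition unitary u := [/\ u ** cstar u = e & cstar u ** u = e].

Lemma twist_unitary l p : projection e -> below p -> cmod l = 1 ->
  unitary (twist l p).
Proof.
move=> pe pp l1; have [pr _ _] := pp.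
split; rewrite twist_star // twistM //; first by rewrite mulCJ // twist1.
by rewrite mulrC mulCJ // twist1.
Qed.

Lemma nrm_unitary u : projection e -> unitary u -> nrm u <= 1.
Proof.
move=> /nrm_projection_le1 ne [_ uu].
rewrite -(@ler_pXn2r _ 2) ?nnegrE ?nrm_ge0 //.
by rewrite -nrm_starM uu expr1n.
Qed.

Lemma unitary_star u : unitary u -> unitary (cstar u).
Proof. by move=> [h1 h2]; split; rewrite cstarK. Qed.

Lemma unitary1 : projection e -> unitary e.
Proof. by move=> [es ee]; split; rewrite es. Qed.

End Corner.

Section UnitalAlgebra.
Variables (R : realType) (F : cstarAlgType R) (n : nat) (e : F).
Hypothesis vF : inhabited (Vector.axiom n F).
Hypothesis eF : algebra_unit e.
Local Notation C := R[i].
Implicit Types (x y a b u v p : F).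

Lemma mul_e_x x : e ** x = x. Proof. by have [] := eF x. Qed.
Lemma mul_x_e x : x ** e = x. Proof. by have [] := eF x. Qed.

Lemma unit_projection : projection e.
Proof.
split; last exact: mul_e_x.
by rewrite -[LHS]mul_e_x -[X in X ** _]cstarK -cstarM mul_e_x cstarK.
Qed.

Lemma below_unit p : projection p -> below e p.
Proof. by split; rewrite ?mul_e_x ?mul_x_e. Qed.

Lemma projection_complement p : projection p -> projection (e - p).
Proof.
move=> [ps pp]; have [es ee] := unit_projection.
split; first by rewrite cstarB es ps.
by rewrite cmulBl !cmulBr !mul_e_x !mul_x_e pp subrr subr0.
Qed.

Lemma unitaryM u v : unitary e u -> unitary e v -> unitary e (u ** v).
Proof.
move=> [u1 u2] [v1 v2]; rewrite /unitary cstarM.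
by split; rewrite -cmulA; [rewrite (cmulA v) v1 mul_e_x | rewrite (cmulA _ u) u2 mul_e_x].
Qed.

Lemma orth_sumM k (p : 'I_k -> F) (l m : 'I_k -> C) :
  (forall i, projection (p i)) -> (forall i j, i != j -> p i ** p j = 0) ->
  (\sum_i l i *: p i) ** (\sum_j m j *: p j) = \sum_i (l i * m i) *: p i.
Proof.
move=> pp porth; rewrite cmul_suml; apply: eq_bigr => i _.
by rewrite -cscaleAl orth_sum_mul // scalerA.
Qed.

(** Compressing [u] and [u - e] by [p_i] gives [l_i p_i] and [(l_i - 1) p_i],
    which yields the two estimates. The sum [r] of the [p_i] satisfies [r u =
    u], hence [r = r u u^* = e]. *)
Lemma unitary_spectral u : unitary e u ->
  exists k (l : 'I_k -> C) (p : 'I_k -> F),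
  [/\ (k <= n)%N, forall i, projection (p i),
    forall i j, i != j -> p i ** p j = 0,
    forall i, cmod (l i) = 1 /\ cmod (l i - 1) <= nrm (u - e) &
    \sum_i p i = e /\ u = \sum_i l i *: p i].
Proof.
move=> uu; have [u1 u2] := uu.
have nu : normal u by rewrite /normal u1 u2.
have [k [l [p [kn pp l0 porth uE]]]] := spectral_decomposition vF nu.
have pp' i : projection (p i) by have [] := pp i.
have pu i : p i ** u = l i *: p i by rewrite uE orth_sum_mul.
have np i : nrm (p i) = 1 by apply: nrm_projection; have [] := pp i.
have n1 := nrm_unitary unit_projection uu.
have n2 := nrm_unitary unit_projection (unitary_star uu).
exists k, l, p; split=> // [i|].
  have nle x : nrm (p i ** x) <= nrm x.
    by apply: le_trans (nrmM _ _) _; rewrite np mul1r.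
  split.
    apply/eqP; rewrite eq_le; apply/andP; split.
      have := nle u; rewrite pu nrmZ np mulr1 => /le_trans; exact.
    have pE : l i *: (p i ** cstar u) = p i.
      by rewrite cscaleAl -pu -cmulA u1 mul_x_e.
    rewrite -(np i) -[X in nrm X]pE nrmZ ler_piMr ?cmod_ge0 //.
    exact: le_trans (nle _) n2.
  apply: le_trans (nle _).
  by rewrite cmulBr pu mul_x_e -{2}[p i]scale1r -scalerBl nrmZ np mulr1.
split=> //; have ru : (\sum_i p i) ** u = u.
  by rewrite cmul_suml [RHS]uE; apply: eq_bigr => i _.
by rewrite -[LHS]mul_x_e -{1}u1 cmulA ru u1.
Qed.

(** The unitary [a + i b] with [b] the square root of [e - a^2], obtained by
    replacing each spectral value [s] of [a] by the square root of [1 - s^2]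
    and taking the value [1] on the complement of the support of [a]. *)
Lemma selfadjoint_unitary a : cstar a = a -> nrm a <= 1 ->
  exists2 u, unitary e u & a = 2^-1 *: (u + cstar u).
Proof.
move=> sa a1; have na : normal a by rewrite /normal sa.
have [k [l [p [_ pp _ porth aE]]]] := spectral_decomposition vF na.
have pp' i : projection (p i) by have [] := pp i.
have pa i : p i ** a = l i *: p i by rewrite aE orth_sum_mul.
have np i : nrm (p i) = 1 by apply: nrm_projection; have [] := pp i.
(* The spectral values are real, because [p_i a p_i] equals both [l_i p_i] and
    its adjoint. *)
have l_real i : l i = (complex.Re (l i))%:C.
  have ap : a ** p i = Num.conj (l i) *: p i.
    have [pis _] := pp' i.
    by rewrite -[in RHS]pis -cstarZ -pa cstarM sa pis.
  have : (l i - Num.conj (l i)) *: p i = 0.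
    have [_ ppi] := pp' i.
    have h1 : p i ** a ** p i = l i *: p i by rewrite pa -cscaleAl ppi.
    have h2 : p i ** a ** p i = Num.conj (l i) *: p i.
      by rewrite -cmulA ap -cscaleAr ppi.
    by rewrite scalerBl -h1 h2 subrr.
  move/eqP; rewrite scaler_eq0; have [_ /negbTE ->] := pp i.
  rewrite orbF subr_eq0; case: (l i) => c d /eqP[/eqP].
  by rewrite -subr_eq0 opprK -mulr2n mulrn_eq0 /= => /eqP ->.
pose s i := complex.Re (l i).
have s1 i : s i ^+ 2 <= 1.
  have : cmod (l i) <= 1.
    have : nrm (p i ** a) <= 1.
      by apply: le_trans (nrmM _ _) _; rewrite np mul1r.
    by rewrite pa nrmZ np mulr1.
  rewrite l_real cmodR -/(s i) => h.
  by rewrite -(real_normK (num_real _)) exprn_ile1 ?normr_ge0.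
pose c i : C := (Num.sqrt (1 - s i ^+ 2))%:C.
have cc i : c i * c i = 1 - l i * l i.
  rewrite /c -rmorphM -expr2 sqr_sqrtr ?subr_ge0 // l_real -/(s i).
  by rewrite -rmorphM -expr2 rmorphB rmorph1.
pose r := \sum_i p i.
have [rs rr] : projection r by apply: projection_sum.
pose b0 := \sum_i c i *: p i.
pose b := b0 + (e - r).
have [es ee] := unit_projection.
have rb0 : r ** b0 = b0.
  rewrite /r /b0 cmul_suml; apply: eq_bigr => i _; exact: orth_sum_mul.
have ra : r ** a = a.
  by rewrite /r cmul_suml [RHS]aE; apply: eq_bigr => i _; rewrite pa.
have sb0 : cstar b0 = b0.
  rewrite cstar_sum; apply: eq_bigr => i _; rewrite cstarZ /c.
  by have [-> _] := pp' i; rewrite conjR.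
have sb : cstar b = b by rewrite /b cstarD cstarB sb0 es rs.
have b0r : b0 ** r = b0 by rewrite -sb0 -{1}rs -cstarM rb0.
have ar : a ** r = a by rewrite -sa -{1}rs -cstarM ra.
have ab : a ** b = b ** a.
  rewrite /b cmulDr cmulDl cmulBr cmulBl mul_e_x mul_x_e ar ra.
  rewrite !subrr !addr0 aE !orth_sumM //.
  by apply: eq_bigr => i _; rewrite mulrC.
have bb : b ** b = e - a ** a.
  have -> : b ** b = b0 ** b0 + (e - r).
    have -> : b ** b = b0 ** b0 + (e ** b0 - r ** b0) + (b0 ** e - b0 ** r)
      + (e ** e - e ** r - (r ** e - r ** r)) by rewrite /b; calg.
    by rewrite !mul_e_x !mul_x_e rb0 b0r rr !subrr !addr0 subr0.
  rewrite aE !orth_sumM // /r.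
  transitivity (\sum_i (p i - (l i * l i) *: p i) + (e - r)).
    congr (_ + _); apply: eq_bigr => i _.
    by rewrite cc scalerBl scale1r.
  by rewrite sumrB addrAC addrCA subrr addr0.
have i2 : 'i%C * 'i%C = -1 :> C by rewrite -expr2 sqr_i.
have su : cstar (a + 'i%C *: b) = a - 'i%C *: b.
  rewrite cstarD sa cstarZ sb -scaleNr; congr (_ + _ *: _).
  by apply/eqP; rewrite eq_complex /= oppr0 !eqxx.
exists (a + 'i%C *: b); last first.
  rewrite su addrACA subrr addr0 -mulr2n -[a *+ 2]scaler_nat scalerA mulVf ?scale1r //.
have key s' : s' * s' = -1 -> (a + s' *: b) ** (a - s' *: b) = e.
  move=> s2; have -> : (a + s' *: b) ** (a - s' *: b) =
    a ** a - (s' * s') *: (b ** b) - s' *: (a ** b - b ** a) by calg.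
  by rewrite s2 ab subrr scaler0 subr0 scaleN1r opprK bb addrCA subrr addr0.
split; rewrite su; first exact: key.
by have := key (- 'i%C); rewrite mulrNN scaleNr opprK; exact.
Qed.

Lemma cartesian_decomposition x : exists a b,
  [/\ cstar a = a, cstar b = b, nrm a <= nrm x, nrm b <= nrm x &
      x = a + 'i%C *: b].
Proof.
have h2 := conj_half R; have c2 := cmod_half R.
pose j : C := - (2^-1 * 'i%C).
have jj : Num.conj j = - j.
  rewrite /j rmorphN rmorphM /= h2; congr (- _).
  by rewrite -mulrN; congr (_ * _); exact: conji.
have cj : cmod j = 2^-1 by rewrite /j cmodN cmodM cmodi c2 mulr1.
exists (2^-1 *: (x + cstar x)), (j *: (x - cstar x)); split.
- by rewrite cstarZ cstarD cstarK h2 addrC.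
- by rewrite cstarZ cstarB cstarK jj scaleNr -scalerN opprB.
- rewrite nrmZ c2; have := nrmD x (cstar x); rewrite nrm_star; lra.
- rewrite nrmZ cj; have := nrmB x (cstar x); rewrite nrm_star; lra.
- rewrite scalerA /j mulrN mulrCA -expr2 sqr_i mulrN1 opprK -scalerDr.
  rewrite addrACA subrr addr0 -mulr2n -[x *+ 2]scaler_nat scalerA mulVf ?scale1r //.
Qed.

Lemma unitary_ind (P : F -> Prop) : (forall u, unitary e u -> P u) ->
  (forall x y, P x -> P y -> P (x + y)) -> (forall l x, P x -> P (l *: x)) ->
  forall x, P x.
Proof.
move=> Pu PD PZ x.
have Psa a : cstar a = a -> P a.
  move=> sa; pose c := nrm a + 1; have c0 : 0 < c by rewrite ltr_wpDl ?nrm_ge0.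
  have cC : c%:C != 0 :> C by rewrite fmorph_eq0 gt_eqF.
  rewrite -[a]scale1r -(mulfV cC) -scalerA; apply: (PZ).
  have [||u uu ->] := @selfadjoint_unitary (c%:C^-1 *: a).
  - by rewrite cstarZ sa -fmorphV conjR.
  - rewrite nrmZ -fmorphV cmodR ger0_norm ?invr_ge0 ?(ltW c0) //.
    by rewrite ler_pdivrMl // mulr1 lerDl.
  by apply/PZ/PD; apply: Pu => //; exact: unitary_star.
have [a [b [sa sb _ _ ->]]] := cartesian_decomposition x.
by apply: PD; [exact: Psa | apply/PZ/Psa].
Qed.

End UnitalAlgebra.

(** * Finite nets in the unit ball *)

Section TotallyBounded.
Variable R : realType.

Lemma interval_net (M h : R) : 0 < h ->
  exists (K : nat) (r : 'I_K.+1 -> R), forall t, `|t| <= M ->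
    exists k, `|t - r k| <= h.
Proof.
move=> h0; exists (Num.truncn ((M + M) / h)), (fun k => k%:R * h - M) => t tM.
have [tm tp] : - M <= t /\ t <= M by apply/andP; rewrite -ler_norml.
have x0 : 0 <= (t + M) / h by rewrite divr_ge0 ?(ltW h0) // -lerBlDr sub0r.
have /andP[k1 k2] := truncn_itv x0.
have kb : (Num.truncn ((t + M) / h) < (Num.truncn ((M + M) / h)).+1)%N.
  by rewrite ltnS le_truncn // ler_pM2r ?invr_gt0 // lerD2r.
exists (Ordinal kb) => /=.
move: k1 k2; move: (Num.truncn ((t + M) / h)) {kb} => N.
rewrite ler_pdivlMr // ltr_pdivrMr // -natr1 mulrDl mul1r.
move=> k1 k2; rewrite ger0_norm; lra.
Qed.

Lemma coord_le m (v : 'rV[R]_m) j : `|v 0 j| <= `|v|.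
Proof.
by rewrite [leRHS]/Num.norm /= mx_normrE; apply/bigmax_geP; right => /=; exists (0, j).
Qed.

Lemma norm_le_coord m (v : 'rV[R]_m) h : 0 <= h -> (forall j, `|v 0 j| <= h) ->
  `|v| <= h.
Proof.
move=> h0 vh; rewrite [leLHS]/Num.norm /= mx_normrE; apply/bigmax_leP; split=> //.
by move=> [i j] _ /=; rewrite (ord1 i).
Qed.

Lemma row_net m (M h : R) : 0 < h -> exists s : seq 'rV[R]_m,
  forall v : 'rV[R]_m, `|v| <= M -> exists2 w, w \in s & `|v - w| <= h.
Proof.
move=> h0; have [K [r rP]] := interval_net M h0.
exists [seq (\row_j r (f j)) | f : {ffun 'I_m -> 'I_K.+1}] => v vM.
have /choice[k kP] j : exists k, `|v 0 j - r k| <= h.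
  by apply: rP; apply: le_trans vM; exact: coord_le.
exists (\row_j r ([ffun j => k j] j)).
  apply/mapP; exists [ffun j => k j]; rewrite ?mem_enum //.
by apply: norm_le_coord => [|j]; rewrite ?(ltW h0) // !mxE ffunE.
Qed.

Variables (V : normedModType R[i]) (m : nat) (L : 'rV[R]_m -> V).
Hypothesis LB : forall v w, L (v - w) = L v - L w.
Hypothesis LZ : forall (t : R) v, L (t *: v) = t%:C *: L v.
Hypothesis L0 : forall v, L v = 0 -> v = 0.
Variable C : R.
Hypothesis C0 : 0 < C.
Hypothesis LC : forall v, nrm (L v) <= C * `|v|.

(** Equivalence of norms: the continuous function [nrm (L v)] has a positive
    minimum on the compact unit sphere of the sup norm. *)
Lemma injective_coercive : exists2 M, 0 < M & forall v, `|v| <= M * nrm (L v).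
Proof.
pose S := [set v : 'rV[R]_m | `|v| = 1].
have L_continuous : continuous (fun v => nrm (L v)).
  move=> v; apply/(@cvgrPdist_le _ _ _ (nbhs v)) => e e0; near=> w.
  have h x y : nrm (L x) - nrm (L y) <= C * `|x - y|.
    have := nrmD (L (x - y)) (L y); rewrite {1}LB subrK.
    have := LC (x - y); lra.
  have ve : C * `|v - w| <= e.
    rewrite -ler_pdivlMl //; near: w.
    apply/nbhs_ballP; exists (C^-1 * e); first by rewrite /= mulr_gt0 ?invr_gt0.
    by move=> w; rewrite -ball_normE => /ltW.
  by rewrite ler_norml; have := h v w; have := h w v; rewrite (distrC w); lra.
have [S0|/set0P S0] := eqVneq S set0.
  exists 1 => // v; have [->|v0] := eqVneq v 0; first by rewrite normr0 mul1r nrm_ge0.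
  have : S (`|v|^-1 *: v) by rewrite /S /= normrZ normfV normr_id mulVf ?normr_eq0.
  by rewrite S0.
have cS : compact S.
  apply: bounded_closed_compact.
    by exists 1; split=> // x x1 v /= ->; exact: ltW.
  apply: (@preimage_closed _ _ (fun v : 'rV[R]_m => `|v|) [set 1]) => //.
  by move=> v _; exact: norm_continuous.
have [c cS' cmin] := compact_EVT_min S0 cS (continuous_subspaceT L_continuous).
move: cS'; rewrite inE => c1.
have Lc : 0 < nrm (L c).
  rewrite lt_neqAle nrm_ge0 andbT eq_sym; apply/eqP => /nrm0_eq0 /L0 c0.
  by move: c1; rewrite /S /= c0 normr0 => /esym/eqP; rewrite oner_eq0.
exists (nrm (L c))^-1; first by rewrite invr_gt0.
move=> v; have [->|v0] := eqVneq v 0.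
  by rewrite normr0 mulr_ge0 ?invr_ge0 ?nrm_ge0.
have vp : 0 < `|v| by rewrite normr_gt0.
have : S (`|v|^-1 *: v) by rewrite /S /= normrZ normfV normr_id mulVf ?normr_eq0.
move=> /mem_set /cmin; rewrite LZ nrmZ cmodR ger0_norm ?invr_ge0 // => h.
by rewrite ler_pdivlMl // -ler_pdivlMr // mulrC.
Unshelve. all: by end_near.
Qed.

(** A grid in the coordinates is mapped to a net, since bounded elements have
    bounded coordinates. *)
Lemma totally_bounded : (forall x, exists v, L v = x) -> forall h : R, 0 < h ->
  exists s : seq V, forall x, nrm x <= 1 -> exists2 y, y \in s & nrm (x - y) <= h.
Proof.
move=> Ls h h0; have [M M0 LM] := injective_coercive.
have [|s sP] := @row_net m M (h / C); first by rewrite divr_gt0.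
exists (map L s) => x x1; have [v vx] := Ls x.
have [|w ws vw] := sP v.
  by apply: le_trans (LM v) _; rewrite vx ler_piMr // ltW.
exists (L w); first exact: map_f.
rewrite -vx -LB; apply: le_trans (LC _) _.
by rewrite -ler_pdivlMl // mulrC.
Qed.

End TotallyBounded.

(** Coordinates are split into real and imaginary parts, so that compactness
    of bounded closed sets of real row vectors applies. *)
Lemma finite_dim_net (R : realType) (V : normedModType R[i]) n :
  inhabited (Vector.axiom n V) -> forall h : R, 0 < h ->
  exists s : seq V, forall x, nrm x <= 1 -> exists2 y, y \in s & nrm (x - y) <= h.
Proof.
move=> [[f linf [g fK gK]]].
pose fl : {linear V -> 'rV[R[i]]_n} := HB.pack f
  (GRing.isLinear.Build _ _ _ _ f linf).
pose c (v : 'rV[R]_(n + n)) (j : 'I_n) : R[i] :=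
  v 0 (lshift n j) +i* v 0 (rshift n j).
pose L v := \sum_j c v j *: g (delta_mx 0 j).
have fL v : f (L v) = \row_j c v j.
  rewrite -[LHS]/(fl (L v)) linear_sum [RHS]row_sum_delta.
  by apply: eq_bigr => j _; rewrite linearZ /= mxE; congr (_ *: _); exact: gK.
pose C := \sum_j (2 * nrm (g (delta_mx 0 j))) + 1.
have S0 : 0 <= \sum_j (2 * nrm (g (delta_mx 0 j))).
  by apply: sumr_ge0 => j _; rewrite mulr_ge0 ?nrm_ge0.
apply: (@totally_bounded R V (n + n) L _ _ _ C); rewrite /C.
- move=> v w; rewrite /L -sumrB; apply: eq_bigr => j _.
  by rewrite -scalerBl /c !mxE.
- move=> t v; rewrite /L scaler_sumr; apply: eq_bigr => j _.
  rewrite scalerA /c !mxE; congr (_ *: _).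
  by apply/eqP; rewrite eq_complex /= !mul0r subr0 addr0 !eqxx.
- move=> v Lv0; have : f (L v) = 0 by rewrite Lv0 -[f 0]/(fl 0) linear0.
  rewrite fL => /rowP cv; apply/rowP => j; rewrite mxE.
  case: (split_ordP j) => k ->; have := cv k; rewrite !mxE /c.
    by move=> [].
  by move=> [].
- by rewrite ltr_wpDl.
- move=> v; rewrite mulrDl mul1r; apply: le_trans (nrm_sum _ _ _) _.
  apply: ler_wpDr => //; rewrite mulr_suml; apply: ler_sum => j _.
  rewrite nrmZ mulrAC; apply: ler_wpM2r; first exact: nrm_ge0.
  have -> : c v j = (v 0 (lshift n j))%:C + 'i%C * (v 0 (rshift n j))%:C.
    by apply/eqP; rewrite eq_complex /= mulr0 !mul0r mul1r subr0 addr0 !add0r !eqxx.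
  apply: le_trans (cmodD _ _) _; rewrite cmodM cmodi !cmodR.
  by rewrite mul1r mulr2n mulrDl mul1r lerD ?coord_le.
- move=> x.
  exists (row_mx (map_mx (@complex.Re R) (f x)) (map_mx (@complex.Im R) (f x))).
  apply: (can_inj fK); rewrite fL; apply/rowP => j.
  by rewrite mxE /c row_mxEl row_mxEr !mxE; case: (f x 0 j).
Qed.

(** * The marriage theorem *)

Section Marriage.
Import boot.fintype boot.finset.
Variables (T1 T2 : finType) (r : T1 -> {set T2}) (y0 : T2).

Definition neighbours (A : {set T1}) : {set T2} := \bigcup_(a in A) r a.

(** Induction on the size of [X]. If some nonempty proper subset [A] has no
    more neighbours than elements, match it first and then match [X] minus [A]
    into the remaining elements. Otherwise every choice of a partner for a
    single element leaves enough neighbours for the others. *)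
Lemma marriage_rec k (X : {set T1}) (Y : {set T2}) : (#|X| <= k)%N ->
  (forall A : {set T1}, A \subset X -> (#|A| <= #|neighbours A :&: Y|)%N) ->
  exists f : T1 -> T2,
    {in X, forall x, f x \in r x :&: Y} /\ {in X &, injective f}.
Proof.
elim: k X Y => [|k IH] X Y Xk hall.
  have -> : X = set0 by apply/eqP; rewrite -cards_eq0 -leqn0.
  by exists (fun=> y0); split=> x; rewrite inE.
have [->|/set0Pn[x xX]] := eqVneq X set0.
  by exists (fun=> y0); split=> x; rewrite inE.
have [[A [A0 AX Ale]]|noA] := pselect (exists A : {set T1},
    [/\ A != set0, A \proper X & (#|neighbours A :&: Y| <= #|A|)%N]).
  have Ak : (#|A| <= k)%N by rewrite -ltnS (leq_trans (proper_card AX)).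
  have [f1 [f1r f1i]] : exists f : T1 -> T2,
      {in A, forall x, f x \in r x :&: Y} /\ {in A &, injective f}.
    apply: IH => // B BA; apply: hall.
    exact: subset_trans BA (proper_sub AX).
  pose Y' := Y :\: neighbours A.
  have [||f2 [f2r f2i]] := IH (X :\: A) Y'.
  - rewrite -ltnS (leq_trans _ Xk) // proper_card //.
    rewrite properEneq subsetDl andbT; apply/eqP => XA.
    have /set0Pn[a aA] := A0; have := subsetP (proper_sub AX) _ aA.
    by rewrite -XA inE aA.
  - move=> B BX.
    have dAB : A :&: B = set0.
      apply/setP => z; rewrite !inE; apply/negP => /andP[zA zB].
      by have := subsetP BX _ zB; rewrite inE zA.
    have sAB : A :|: B \subset X.
      rewrite subUset (proper_sub AX) /=; apply: subset_trans BX _.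
      exact: subsetDl.
    have := hall _ sAB; rewrite cardsU dAB cards0 subn0.
    have -> : neighbours (A :|: B) = neighbours A :|: neighbours B.
      by rewrite /neighbours bigcup_setU.
    have -> : (neighbours A :|: neighbours B) :&: Y =
        (neighbours A :&: Y) :|: (neighbours B :&: Y').
      apply/setP => z; rewrite !inE.
      by case: (z \in neighbours A); case: (z \in Y); case: (z \in neighbours B).
    move=> h; have := leq_trans h (leq_card_setU _ _).
    by move: Ale; lia.
  exists (fun z => if z \in A then f1 z else f2 z); split.
    move=> z zX; case: ifP => zA; first exact: f1r.
    have /f2r : z \in X :\: A by rewrite inE zA zX.
    by rewrite !inE => /andP[-> /andP[_ ->]].
  have sep z w : z \in A -> w \in X :\: A -> f1 z != f2 w.
    move=> zA wX; apply/eqP => fzw.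
    have := f1r _ zA; rewrite fzw inE => /andP[zr _].
    have := f2r _ wX; rewrite !inE => /andP[_ /andP[/negP wA _]].
    by apply: wA; apply/bigcupP; exists z.
  move=> z w zX wX; case: ifP => zA; case: ifP => wA.
  - exact: f1i.
  - have wXA : w \in X :\: A by rewrite inE wA wX.
    by move/eqP; rewrite (negbTE (sep _ _ zA wXA)).
  - have zXA : z \in X :\: A by rewrite inE zA zX.
    by move/esym/eqP; rewrite (negbTE (sep _ _ wA zXA)).
  - by apply: f2i; rewrite inE ?zA ?wA.
have strict A : A != set0 -> A \proper X -> (#|A| < #|neighbours A :&: Y|)%N.
  by move=> A0 AX; rewrite ltnNge; apply/negP => Ale; apply: noA; exists A.
have /card_gt0P[y] : (0 < #|neighbours [set x] :&: Y|)%N.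
  by apply: leq_trans (hall _ _); rewrite ?cards1 // sub1set.
rewrite /neighbours big_set1 => yr; have yY : y \in Y by move: yr; rewrite inE => /andP[].
have [||f [fr fi]] := IH (X :\ x) (Y :\ y).
- by move: Xk; rewrite (cardsD1 x) xX.
- move=> A AX; have [->|A0] := eqVneq A set0; first by rewrite cards0.
  have /(strict _ A0) : A \proper X.
    apply: sub_proper_trans AX _; rewrite properEneq subsetDl andbT.
    by apply/eqP => XX; have := xX; rewrite -XX !inE eqxx.
  have -> : neighbours A :&: (Y :\ y) = (neighbours A :&: Y) :\ y.
    by apply/setP => z; rewrite !inE; case: (z == y); rewrite ?andbF.
  by rewrite (cardsD1 y (_ :&: Y)); case: (y \in _) => /=; lia.
exists (fun z => if z == x then y else f z); split.
  move=> z zX; case: eqP => [->|/eqP zx] //.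
  have /fr : z \in X :\ x by rewrite !inE zx.
  by rewrite !inE => /andP[-> /andP[_ ->]].
have sep z : z \in X -> z != x -> f z != y.
  move=> zX zx; have /fr : z \in X :\ x by rewrite !inE zx.
  by rewrite !inE => /andP[_ /andP[]].
move=> z w zX wX; case: eqP => [->|/eqP zx]; case: eqP => [->|/eqP wx] //.
- by move/esym/eqP; rewrite (negbTE (sep _ wX wx)).
- by move/eqP; rewrite (negbTE (sep _ zX zx)).
- by apply: fi; rewrite !inE ?zx ?wx.
Qed.

Lemma marriage : (forall A : {set T1}, (#|A| <= #|neighbours A|)%N) ->
  exists2 f : T1 -> T2, injective f & forall x, f x \in r x.
Proof.
move=> hall; have [A _|f [fr fi]] := @marriage_rec #|[set: T1]| setT setT (leqnn _).
  by rewrite setIT.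
by exists f => [x y|x]; [apply: fi; rewrite inE | have := fr x; rewrite setIT inE; exact].
Qed.

End Marriage.

(** * Almost invariant means on the unitary group *)

Section ApproximateMean.
Variables (R : realType) (F : cstarAlgType R) (n : nat) (e : F).
Hypothesis vF : inhabited (Vector.axiom n F).
Hypothesis eF : algebra_unit e.

Lemma nrm_mul_unitary x g : unitary e g -> nrm (x ** g) <= nrm x.
Proof.
move=> ug; apply: le_trans (nrmM _ _) _.
by rewrite ler_piMr ?nrm_ge0 // (nrm_unitary (unit_projection eF) ug).
Qed.

Definition unitary_net (h : R) (t : seq F) : Prop :=
  (forall x, x \in t -> unitary e x) /\
  forall u, unitary e u -> exists2 x, x \in t & nrm (u - x) <= h.

(** A net of the unit ball may avoid the unitaries; each of its points is
    replaced by a unitary that is close to it, if there is one. *)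
Lemma unitary_net_exists h : 0 < h -> exists t, unitary_net h t.
Proof.
move=> h0; have [|s sP] := @finite_dim_net R F n vF (h / 2); first by rewrite divr_gt0.
have pr := unit_projection eF.
have /choice[c cP] x : exists u, unitary e u /\
    ((exists2 v, unitary e v & nrm (v - x) <= h / 2) -> nrm (u - x) <= h / 2).
  have [[v uv vx]|nv] := pselect (exists2 v, unitary e v & nrm (v - x) <= h / 2).
    by exists v.
  by exists e; split; [exact: unitary1 | move=> /nv].
exists (map c s); split=> [x /mapP[y _ ->]|u uu]; first by have [] := cP y.
have [y ys uy] := sP u (nrm_unitary pr uu).
exists (c y); first exact: map_f.
have [_ cy] := cP y; apply: le_trans (nrm_tri y _ _) _.
have := cy (ex_intro2 _ _ u uu uy); rewrite (nrm_distC y); lra.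
Qed.

(** Take a net [t] of least cardinality. For a set [A] of indices, the points
    [s_i g] with [i] outside [A] together with the [s_j] near some [s_i g]
    with [i] in [A] again form a net, and minimality gives the hypothesis of
    the marriage theorem. *)
Theorem approximate_mean h : 0 < h -> exists m (s : 'I_m.+1 -> F),
  (forall i, unitary e (s i)) /\
  forall g, unitary e g -> exists2 f : 'I_m.+1 -> 'I_m.+1, injective f &
    forall i, nrm (s i ** g - s (f i)) <= h.
Proof.
move=> h0; have h2 : 0 < h / 2 by rewrite divr_gt0.
pose P k := `[< exists2 t, unitary_net (h / 2) t & size t = k >].
have exP : exists k, P k.
  by have [t tn] := unitary_net_exists h2; exists (size t); apply/asboolP; exists t.
case: (ex_minnP exP) => k /asboolP[t [tu tn] <-] tmin.
have pr := unit_projection eF.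
have : (0 < size t)%N.
  by have [x] := tn e (unitary1 pr); case: (t).
case tE : (size t) => [//|m] _.
pose s (i : 'I_m.+1) := nth 0 t i.
have st i : s i \in t by rewrite mem_nth // tE.
have us i : unitary e (s i) by apply: tu.
have sn u : unitary e u -> exists i, nrm (u - s i) <= h / 2.
  move=> /tn[x xt ux]; have ix : (index x t < m.+1)%N by rewrite -tE index_mem.
  by exists (Ordinal ix); rewrite /s /= nth_index.
exists m, s; split=> // g ug.
pose r (i : 'I_m.+1) := [set j | nrm (s i ** g - s j) <= h]%SET.
have [|f fi fr] := @marriage _ _ r ord0; last first.
  by exists f => // i; have := fr i; rewrite inE.
move=> A.
pose t' := [seq s i ** g | i in ~: A] ++ [seq s j | j in neighbours r A].
suff : unitary_net (h / 2) t'.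
  move=> nt'; have := tmin (size t').
  rewrite tE /P; have -> : `[< exists2 t0, unitary_net (h / 2) t0 & size t0 = size t' >].
    by apply/asboolP; exists t'.
  move=> /(_ isT); rewrite size_cat !size_image.
  have := cardsC A; rewrite card_ord; lia.
split=> [x|u uu].
  rewrite mem_cat => /orP[] /mapP[i _ ->]; last exact: us.
  exact: unitaryM.
have [_ g2] := ug; have [g1 _] := ug.
have [|i ui] := sn (u ** cstar g).
  by apply: unitaryM => //; exact: unitary_star.
(* Right multiplication by a unitary does not increase norms. *)
have ui' : nrm (u - s i ** g) <= h / 2.
  apply: le_trans ui; rewrite -[u in leLHS](mul_x_e eF) -g2 cmulA -cmulBl.
  exact: nrm_mul_unitary.
have [iA|iA] := boolP (i \in A); last first.
  exists (s i ** g) => //; rewrite mem_cat; apply/orP; left.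
  by apply/mapP; exists i; rewrite ?mem_enum ?inE.
have [j uj] := sn u uu; exists (s j) => //.
rewrite mem_cat; apply/orP; right; apply/mapP; exists j => //; rewrite mem_enum.
apply/bigcupP; exists i => //; rewrite inE.
apply: le_trans (nrm_tri u _ _) _; rewrite (nrm_distC _ u); lra.
Qed.

End ApproximateMean.

(** * Limits of improving iterations *)

Section Iteration.
Variable R : realType.

Lemma geometric_small (d : R) : 0 < d -> forall t, 0 < t ->
  exists k, d * 2^-1 ^+ k <= t.
Proof.
move=> d0 t t0; exists (Num.truncn (d / t)).+1.
have /andP[_ k1] := truncn_itv (ltW (divr_gt0 d0 t0)).
rewrite exprVn ler_pdivrMr ?exprn_gt0 //.
rewrite mulrC -ler_pdivrMr //; apply: le_trans (ltW k1) _.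
by rewrite -natrX ler_nat; apply: ltnW; apply: ltn_expl.
Qed.

Lemma nrm_small_eq0 (V : normedModType R[i]) (x : V) c :
  (forall t, 0 < t -> t <= 1 -> nrm x <= c * t) -> x = 0.
Proof.
move=> h; apply: nrm0_eq0; apply/eqP; rewrite eq_le nrm_ge0 andbT.
apply/ler_addgt0Pr => t t0; rewrite add0r.
have c0 : 0 <= c by apply: le_trans (nrm_ge0 x) _; rewrite -[c]mulr1 h.
pose s := Num.min 1 (t / (c + 1)).
have c1 : 0 < c + 1 by rewrite ltr_wpDl.
have s0 : 0 < s by rewrite lt_min ltr01 divr_gt0.
have s1 : s <= 1 by rewrite ge_min lexx.
apply: le_trans (h s s0 s1) _.
have : s <= t / (c + 1) by rewrite ge_min lexx orbT.
rewrite ler_pdivlMr // mulrDr mulr1 mulrC; lra.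
Qed.

(** If an approximate solution [f] of quality [d] can always be moved by at
    most [c d] to one of quality [d / 2], the iterates converge geometrically.
    The set [D] restricts where the functions are controlled. *)
Lemma geometric_limit (V : completeNormedModType R[i]) (I : Type)
    (D : I -> Prop) (P : R -> (I -> V) -> Prop) (c d0 : R) (f0 : I -> V) :
  0 < d0 -> 0 <= c ->
  (forall d f, 0 < d -> d <= d0 -> P d f -> exists2 g, P (d / 2) g &
    forall i, D i -> nrm (f i - g i) <= c * d) ->
  P d0 f0 ->
  exists2 g : I -> V, forall i, D i -> nrm (f0 i - g i) <= 2 * c * d0 &
    forall t, 0 < t -> exists d f, [/\ 0 < d, d <= t, P d f &
      forall i, D i -> nrm (f i - g i) <= 2 * c * t].
Proof.
move=> d00 c0 step Pf0.
pose d k := d0 * 2^-1 ^+ k.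
have dS k : d k.+1 = d k / 2 by rewrite /d exprSr mulrA.
have dp k : 0 < d k by rewrite mulr_gt0 // exprn_gt0 // invr_gt0.
have dle k : d k <= d0.
  by rewrite ler_piMr ?(ltW d00) // exprn_ile1 // ?invr_ge0 // invf_le1 // ler1n.
have /choice[nx nxP] (z : nat * (I -> V)) : exists g, P (d z.1) z.2 ->
    P (d z.1.+1) g /\ forall i, D i -> nrm (z.2 i - g i) <= c * d z.1.
  have [Pz|nP] := pselect (P (d z.1) z.2); last by exists z.2.
  have [g Pg gz] := step _ _ (dp z.1) (dle z.1) Pz.
  by exists g; rewrite dS.
pose fix f k : I -> V := if k is k'.+1 then nx (k', f k') else f0.
have Pf k : P (d k) (f k).
  by elim: k => [|k IH]; [rewrite /d mulr1 | exact: (nxP (k, f k) IH).1].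
have fS k i : D i -> nrm (f k i - f k.+1 i) <= c * d k.
  exact: (nxP (k, f k) (Pf k)).2.
have fle i k m : D i -> (k <= m)%N -> nrm (f m i - f k i) <= 2 * c * d k.
  move=> Di; move=> /subnK <-; move: (m - k)%N => j; elim: j k {m} => [|j IH] k.
    by rewrite subrr nrm0 !mulr_ge0 // ltW.
  rewrite addSnnS; apply: le_trans (nrm_tri (f k.+1 i) _ _) _.
  have := IH k.+1; rewrite (nrm_distC (f k.+1 i)) dS; have := fS k i Di; lra.
have small t : 0 < t -> exists k, d k <= t by exact: geometric_small.
have /choice[g gP] i : exists l, D i -> forall k, nrm (f k i - l) <= 2 * c * d k.
  have [Di|nD] := pselect (D i); last by exists 0.
  have [t t0|k m km|l lP] := @nrm_complete R V (f^~ i) (fun k => 2 * c * d k).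
  - have c1 : 0 < 2 * c + 1 by rewrite ltr_wpDl ?mulr_ge0.
    have [k dk] := small (t / (2 * c + 1)) (divr_gt0 t0 c1); exists k.
    move: dk; rewrite ler_pdivlMr // mulrDr mulr1; have := dp k; lra.
  - exact: fle.
  - by exists l.
exists g => [i Di|t t0].
  by have := gP i Di 0%N; rewrite /= /d expr0 mulr1.
have [k dk] := small t t0.
exists (d k), (f k); split=> // i Di; apply: le_trans (gP i Di k) _.
by rewrite ler_wpM2l // mulr_ge0.
Qed.

Lemma nrm_mul_diff (A : cstarAlgType R) (x y x' y' : A) :
  nrm (x ** y - x' ** y') <= nrm (x - x') * nrm y + nrm x' * nrm (y - y').
Proof.
have -> : x ** y - x' ** y' = (x - x') ** y + x' ** (y - y') by calg.
by apply: le_trans (nrmD _ _) _; rewrite lerD // nrmM.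
Qed.

(** Newton's iteration [x |-> 3 x^2 - 2 x^3]: with [y = x^2 - x] the new error
    is [4 y^3 - 3 y^2]. The bound [2 - 10 t] on the norm is chosen so that a
    step of length at most [5 t] preserves it when [t] is halved. *)
Lemma projection_near (A : cstarAlgType R) (h : A) (d : R) :
  0 < d -> d <= 1/10 -> cstar h = h -> nrm (h ** h - h) <= d ->
  nrm h <= 2 - 10 * d ->
  exists2 q, projection q & nrm (h - q) <= 10 * d.
Proof.
move=> d0 d10 sh hh h1.
pose P (t : R) (f : unit -> A) := [/\ cstar (f tt) = f tt,
  nrm (f tt ** f tt - f tt) <= t & nrm (f tt) <= 2 - 10 * t].
have [|t f t0 td [sf ft f2]||g gP glim] :=
  @geometric_limit A unit (fun=> True) P 5 d (fun=> h) d0.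
- by [].
- pose x := f tt; pose y := x ** x - x; pose z := x + y - 2 *: (x ** y).
  have sy : cstar y = y by rewrite /y cstarB cstarM sf.
  have xy : y ** x = x ** y by rewrite /y; calg.
  have zz : z ** z - z = 4 *: (y ** (y ** y)) - 3 *: (y ** y).
    by rewrite /z /y; calg.
  have nxy : nrm (x - z) <= 5 * t.
    have -> : x - z = 2 *: (x ** y) - y by rewrite /z; calg.
    have := nrmB (2 *: (x ** y)) y; rewrite nrmZ cmod_nat; have := nrmM x y.
    have := nrm_ge0 x; have := nrm_ge0 y; rewrite -/x -/y in ft f2.
    nra.
  exists (fun=> z) => [|[] _ //]; split.
  + by rewrite /z cstarB cstarD cstarZ cstarM sf sy xy rmorph_nat.
  + rewrite zz; have := nrmB (4 *: (y ** (y ** y))) (3 *: (y ** y)).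
    rewrite !nrmZ !cmod_nat.
    have yy := nrmM y y; have yyy := nrmM y (y ** y).
    have y0 := nrm_ge0 y; rewrite -/x -/y in ft f2.
    have h2 : nrm y * nrm y <= t / 10 by nra.
    have h3 : nrm y * nrm (y ** y) <= t / 100 by nra.
    lra.
  + have := nrmB x (x - z); rewrite opprB addrC subrK; rewrite -/x in f2; lra.
- by split.
exists (g tt); last by have := gP tt I; lra.
have approx t : 0 < t -> exists x, [/\ cstar x = x, nrm (x ** x - x) <= t,
    nrm x <= 2 & nrm (x - g tt) <= 10 * t].
  move=> t0; have [d' [f [d'0 d't [sf ft f2] fg]]] := glim t t0.
  by exists (f tt); split=> //; [lra | lra | have := fg tt I; lra].
split; apply/subr0_eq.
  apply: (@nrm_small_eq0 _ _ 20) => t t0 _; have [x [sx _ _ xg]] := approx t t0.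
  have -> : cstar (g tt) - g tt = (x - g tt) - cstar (x - g tt).
    by rewrite cstarB sx; calg.
  by have := nrmB (x - g tt) (cstar (x - g tt)); rewrite nrm_star; lra.
apply: (@nrm_small_eq0 _ _ 200) => t t0 t1; have [x [_ xx x2 xg]] := approx t t0.
have -> : g tt ** g tt - g tt = (x ** x - x) + (x - g tt) -
    (x ** x - g tt ** g tt) by calg.
have := nrmB ((x ** x - x) + (x - g tt)) (x ** x - g tt ** g tt).
have := nrmD (x ** x - x) (x - g tt).
have := nrm_mul_diff x x (g tt) (g tt).
have : nrm (g tt) <= 12.
  by have := nrmB x (x - g tt); rewrite opprB addrC subrK; lra.
have := nrm_ge0 (x - g tt); have := nrm_ge0 (g tt); have := nrm_ge0 x; nra.
Qed.

End Iteration.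

(** * Improving approximate representations *)

Section Average.
Variables (R : realType) (A : cstarAlgType R) (m : nat).
Implicit Types (f g : 'I_m.+1 -> A) (x : A).

Definition avg f : A := m.+1%:R^-1 *: \sum_i f i.

Lemma nrm_avg f b : (forall i, nrm (f i) <= b) -> nrm (avg f) <= b.
Proof.
move=> fb; rewrite nrmZ; have -> : cmod (m.+1%:R^-1 : R[i]) = m.+1%:R^-1.
  rewrite -(rmorph_nat (real_complex R)) -fmorphV cmodR.
  by rewrite ger0_norm ?invr_ge0.
rewrite mulrC ler_pdivrMr ?ltr0n //; apply: le_trans (nrm_sum _ _ _) _.
apply: (@le_trans _ _ (\sum_(i < m.+1) b)); first by apply: ler_sum.
by rewrite sumr_const card_ord mulr_natr.
Qed.

Lemma avg_cst x : avg (fun=> x) = x.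
Proof.
by rewrite /avg sumr_const card_ord -[x *+ _]scaler_nat scalerA mulVf ?scale1r // pnatr_eq0.
Qed.

Lemma avgD f g : avg (fun i => f i + g i) = avg f + avg g.
Proof. by rewrite /avg big_split scalerDr. Qed.

Lemma avgB f g : avg (fun i => f i - g i) = avg f - avg g.
Proof. by rewrite /avg sumrB scalerBr. Qed.

Lemma avgMl x f : x ** avg f = avg (fun i => x ** f i).
Proof. by rewrite /avg -cscaleAr cmul_sumr. Qed.

Lemma avgMr x f : avg f ** x = avg (fun i => f i ** x).
Proof. by rewrite /avg -cscaleAl cmul_suml. Qed.

Lemma eq_avg f g : f =1 g -> avg f = avg g.
Proof. by move=> fg; rewrite /avg (eq_bigr g). Qed.

Lemma avg_reindex f (s : 'I_m.+1 -> 'I_m.+1) : injective s ->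
  avg f = avg (f \o s).
Proof. by move=> si; rewrite /avg (reindex_inj si). Qed.

End Average.

Section ApproximateRepresentation.
Variables (R : realType) (F A : cstarAlgType R) (n : nat) (e : F) (q : A).
Hypothesis vF : inhabited (Vector.axiom n F).
Hypothesis eF : algebra_unit e.
Hypothesis pq : projection q.
Local Notation U := (unitary e).
Let pe := unit_projection eF.

(** The bound [2 - 4 d] leaves room for all later corrections: a step moves
    the map by at most [2 d] and halves [d]. *)
Record approx_rep (d : R) (T : F -> A) : Prop := ApproxRep {
  rep_lip : exists2 L, 0 <= L &
    forall u v, U u -> U v -> nrm (T u - T v) <= L * nrm (u - v);
  rep_star : forall u, U u -> T (cstar u) = cstar (T u);
  rep_unit : T e = q;
  rep_corner : forall u, U u -> q ** T u = T u /\ T u ** q = T u;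
  rep_bound : forall u, U u -> nrm (T u) <= 2 - 4 * d;
  rep_mul : forall u v, U u -> U v -> nrm (T (u ** v) - T u ** T v) <= d }.

Section Step.
Variables (d L : R) (T : F -> A).
Hypothesis d0 : 0 < d.
Hypothesis d1 : d <= 1 / 40.
Hypothesis rT : approx_rep d T.
Hypothesis L0 : 0 <= L.
Hypothesis TL : forall u v, U u -> U v -> nrm (T u - T v) <= L * nrm (u - v).
Variables (m : nat) (s : 'I_m.+1 -> F).
Hypothesis sU : forall i, U (s i).
Hypothesis s_inv : forall g, U g -> exists2 f : 'I_m.+1 -> 'I_m.+1, injective f &
    forall i, nrm (s i ** g - s (f i)) <= d / (4 * (7 * L + 1)).

Let uM u v : U u -> U v -> U (u ** v) := unitaryM eF (u := u) (v := v).
Let uS u : U u -> U (cstar u) := @unitary_star _ _ e u.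
Let n1 u : U u -> nrm u <= 1 := nrm_unitary pe (u := u).
Let b2 u : U u -> nrm (T u) <= 2.
Proof. by move=> /(rep_bound rT); have := d0; lra. Qed.
Let uMl x u : U u -> nrm (u ** x) <= nrm x.
Proof.
by move=> uu; apply: le_trans (nrmM _ _) _; rewrite ler_piMl ?nrm_ge0 // n1.
Qed.

Definition defect u v := T (u ** v) - T u ** T v.
(** Averaging the cocycle identity over its first variable shows that the
    coboundary of this map is the defect, up to second order and up to the
    error of the mean. *)
Definition correction u := avg (fun i => T (cstar (s i)) ** defect (s i) u).
Definition corrected u := T u + correction u.

Let D_le u v : U u -> U v -> nrm (defect u v) <= d.
Proof. exact: rep_mul. Qed.

Lemma defect_lip u u' v : U u -> U u' -> U v ->
  nrm (defect u v - defect u' v) <= 3 * L * nrm (u - u').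
Proof.
move=> uu uu' uv; have L0' := L0.
have -> : defect u v - defect u' v =
    (T (u ** v) - T (u' ** v)) - (T u ** T v - T u' ** T v).
  by rewrite /defect; calg.
apply: le_trans (nrmB _ _) _.
have h1 := TL (uM uu uv) (uM uu' uv).
have h2 := nrm_mul_diff (T u) (T v) (T u') (T v).
have h3 := TL uu uu'; have h4 := b2 uv.
have h5 : nrm (u ** v - u' ** v) <= nrm (u - u').
  by rewrite -cmulBl; exact: (nrm_mul_unitary eF).
move: h2; rewrite subrr nrm0 mulr0 addr0.
have := nrm_ge0 (T u - T u'); have := nrm_ge0 (u - u'); nra.
Qed.

(** Associativity of the product, written in terms of the defect. *)
Lemma defect_cocycle t u v : U t -> U u -> U v ->
  defect t (u ** v) =
  defect (t ** u) v - T t ** defect u v + defect t u ** T v.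
Proof. by move=> *; rewrite /defect cmulA; calg. Qed.

Lemma correction_le u : U u -> nrm (correction u) <= 2 * d.
Proof.
move=> uu; apply: nrm_avg => i; apply: le_trans (nrmM _ _) _.
by apply: ler_pM; rewrite ?nrm_ge0 ?D_le ?b2 //; exact: uS.
Qed.

Lemma star_mulVK u v : U u -> U v -> u ** cstar (v ** u) = cstar v.
Proof. by move=> [u1 _] _; rewrite cstarM cmulA u1 (mul_e_x eF). Qed.

(** Both averages are averages of [t |-> T(u t^* ) D(t, v)], over [s_i u] and
    over [s_i], and this function is Lipschitz with constant at most [7 L]. *)
Lemma average_shift u v : U u -> U v ->
  nrm (avg (fun i => T (cstar (s i)) ** defect (s i ** u) v) -
       avg (fun i => T (u ** cstar (s i)) ** defect (s i) v)) <= d / 4.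
Proof.
move=> uu uv; have [f fi fs] := s_inv uu; have d0' := d0; have d1' := d1; have L0' := L0.
pose G t := T (u ** cstar t) ** defect t v.
rewrite (avg_reindex (fun i => T (u ** cstar (s i)) ** defect (s i) v) fi).
rewrite -avgB; apply: nrm_avg => i /=.
have -> : T (cstar (s i)) ** defect (s i ** u) v = G (s i ** u).
  by rewrite /G star_mulVK.
rewrite -/(G (s (f i))).
have uf := sU (f i); have usu := uM (sU i) uu.
apply: le_trans (nrm_mul_diff _ _ _ _) _.
have h1 := TL (uM uu (uS usu)) (uM uu (uS uf)).
have h2 : nrm (u ** cstar (s i ** u) - u ** cstar (s (f i))) <= nrm (s i ** u - s (f i)).
  rewrite -cmulBr -cstarB -[leRHS]nrm_star; exact: uMl.
have h3 := D_le usu uv; have h4 := b2 (uM uu (uS uf)).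
have h5 := defect_lip usu uf uv.
have h6 := fs i; set t := nrm (s i ** u - s (f i)) in h2 h5 h6 *.
have t0 : 0 <= t by exact: nrm_ge0.
have p1 := nrm_ge0 (T (u ** cstar (s i ** u)) - T (u ** cstar (s (f i)))).
have p2 := nrm_ge0 (defect (s i ** u) v).
have p3 := nrm_ge0 (T (u ** cstar (s (f i)))).
have p4 := nrm_ge0 (defect (s i ** u) v - defect (s (f i)) v).
have k1 : nrm (T (u ** cstar (s i ** u)) - T (u ** cstar (s (f i)))) <= L * t.
  by apply: le_trans h1 _; rewrite ler_wpM2l.
have L7 : 0 < 4 * (7 * L + 1) by lra.
have k2 : 7 * L * t <= d / 4.
  move: h6; rewrite ler_pdivlMr // => h6; nra.
have k3 := ler_pM p1 p2 k1 h3.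
have k4 := ler_pM p3 p4 h4 h5.
have Lt0 : 0 <= L * t by rewrite mulr_ge0.
apply: le_trans (lerD k3 k4) _; nra.
Qed.

(** By the cocycle identity the new defect is the sum of [t1] and [t3], which
    are averages of products of two defects, of the error [t2] caused by the
    shift of the average, and of a product of two corrections. *)
Lemma corrected_defect u v : U u -> U v ->
  nrm (corrected (u ** v) - corrected u ** corrected v) <= 6 * d ^+ 2 + d / 4.
Proof.
move=> uu uv; have d0' := d0.
pose t1 := avg (fun i => defect (cstar (s i)) (s i) ** defect u v).
pose t2 := avg (fun i => T (cstar (s i)) ** defect (s i ** u) v) -
  avg (fun i => T (u ** cstar (s i)) ** defect (s i) v).
pose t3 := avg (fun i => defect u (cstar (s i)) ** defect (s i) v).
have qD : q ** defect u v = defect u v.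
  rewrite /defect cmulBr cmulA; have [-> _] := rep_corner rT uu.
  by have [-> _] := rep_corner rT (uM uu uv).
have t1E : t1 = defect u v - avg (fun i => T (cstar (s i)) ** T (s i) ** defect u v).
  rewrite -[X in _ = X - _]qD -(avg_cst m (q ** defect u v)) -avgB; apply: eq_avg => i /=.
  by rewrite -cmulBl; congr (_ ** _); rewrite /defect; have [_ ->] := sU i; rewrite (rep_unit rT).
have t3E : t3 = avg (fun i => T (u ** cstar (s i)) ** defect (s i) v) -
    T u ** correction v.
  rewrite /correction avgMl -avgB; apply: eq_avg => i /=.
  by rewrite cmulA -cmulBl.
have cE : correction (u ** v) =
    avg (fun i => T (cstar (s i)) ** defect (s i ** u) v)
    - avg (fun i => T (cstar (s i)) ** T (s i) ** defect u v)
    + correction u ** T v.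
  rewrite /correction avgMr -avgB -avgD; apply: eq_avg => i /=.
  by rewrite defect_cocycle //; calg.
have -> : corrected (u ** v) - corrected u ** corrected v =
    t1 + t2 + t3 - correction u ** correction v.
  by rewrite /corrected cE t1E t3E /t2 /defect; calg.
have h1 : nrm t1 <= d ^+ 2.
  apply: nrm_avg => i; apply: le_trans (nrmM _ _) _.
  by rewrite expr2 ler_pM ?nrm_ge0 ?D_le //; exact: uS.
have h2 : nrm t2 <= d / 4 by exact: average_shift.
have h3 : nrm t3 <= d ^+ 2.
  apply: nrm_avg => i; apply: le_trans (nrmM _ _) _.
  by rewrite expr2 ler_pM ?nrm_ge0 ?D_le //; exact: uS.
have h4 : nrm (correction u ** correction v) <= 4 * d ^+ 2.
  apply: le_trans (nrmM _ _) _; have -> : 4 * d ^+ 2 = (2 * d) * (2 * d) by ring.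
  by rewrite ler_pM ?nrm_ge0 ?correction_le.
have := nrmB (t1 + t2 + t3) (correction u ** correction v).
have := nrmD (t1 + t2) t3; have := nrmD t1 t2; lra.
Qed.

Lemma corrected_lip u v : U u -> U v ->
  nrm (corrected u - corrected v) <= 7 * L * nrm (u - v).
Proof.
move=> uu uv; have L0' := L0.
have -> : corrected u - corrected v = (T u - T v) +
    avg (fun i => T (cstar (s i)) ** (defect (s i) u - defect (s i) v)).
  rewrite /corrected; have <- : correction u - correction v =
    avg (fun i => T (cstar (s i)) ** (defect (s i) u - defect (s i) v)).
    by rewrite /correction -avgB; apply: eq_avg => i /=; rewrite cmulBr.
  by calg.
apply: le_trans (nrmD _ _) _.
suff : nrm (avg (fun i => T (cstar (s i)) ** (defect (s i) u - defect (s i) v)))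
    <= 2 * (3 * L * nrm (u - v)) by have := TL uu uv; lra.
apply: nrm_avg => i; apply: le_trans (nrmM _ _) _.
apply: ler_pM; rewrite ?nrm_ge0 //; first by apply: b2; exact: uS.
have si := sU i.
have -> : defect (s i) u - defect (s i) v =
    (T (s i ** u) - T (s i ** v)) - (T (s i) ** T u - T (s i) ** T v).
  by rewrite /defect; calg.
apply: le_trans (nrmB _ _) _.
have h1 := TL (uM si uu) (uM si uv).
have h2 : nrm (T (s i) ** T u - T (s i) ** T v) <= nrm (T (s i)) * nrm (T u - T v).
  by rewrite -cmulBr nrmM.
have h3 := TL uu uv; have h4 := b2 si.
have h5 : nrm (s i ** u - s i ** v) <= nrm (u - v).
  by rewrite -cmulBr; exact: uMl.
have p1 := nrm_ge0 (T u - T v); have p2 := nrm_ge0 (u - v).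
have p3 := nrm_ge0 (T (s i)).
have k1 := ler_pM p3 p1 h4 h3.
have k2 := ler_wpM2l L0 h5.
lra.
Qed.

Lemma corrected_unit : corrected e = q.
Proof.
rewrite /corrected (rep_unit rT) /correction -[RHS]addr0; congr (_ + _).
rewrite -(avg_cst m (0 : A)); apply: eq_avg => i.
rewrite /defect (mul_x_e eF) (rep_unit rT).
by have [_ ->] := rep_corner rT (sU i); rewrite subrr cmulx0.
Qed.

Lemma corrected_corner u : U u ->
  q ** corrected u = corrected u /\ corrected u ** q = corrected u.
Proof.
move=> uu; have [q1 q2] := rep_corner rT uu.
rewrite /corrected cmulDr cmulDl q1 q2 /correction avgMl avgMr.
split; congr (_ + _); apply: eq_avg => i.
  by rewrite cmulA; have [-> _] := rep_corner rT (uS (sU i)).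
rewrite -cmulA /defect cmulBl -[(_ ** T u) ** q]cmulA q2.
by have [_ ->] := rep_corner rT (uM (sU i) uu).
Qed.

(** The mean of two nearly multiplicative maps at distance [r] has a defect
    increased by only [r^2 / 4]. *)
Definition symmetrized u : A := 2^-1 *: (corrected u + cstar (corrected (cstar u))).

Let half := cmod_half R.

Lemma corrected_close u : U u -> nrm (T u - corrected u) <= 2 * d.
Proof.
move=> uu; rewrite /corrected opprD addrA subrr add0r nrmN.
exact: correction_le.
Qed.

Lemma corrected_star_close u : U u ->
  nrm (T u - cstar (corrected (cstar u))) <= 2 * d.
Proof.
move=> uu; rewrite -[T u]cstarK -(rep_star rT uu) -cstarB nrm_star.
exact: corrected_close (uS uu).
Qed.

Lemma symmetrized_close u : U u -> nrm (T u - symmetrized u) <= 2 * d.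
Proof.
move=> uu; have -> : T u - symmetrized u =
    2^-1 *: ((T u - corrected u) + (T u - cstar (corrected (cstar u)))).
  by rewrite /symmetrized; calg_raw; repeat split; field.
rewrite nrmZ half; have := nrmD (T u - corrected u) (T u - cstar (corrected (cstar u))).
have := corrected_close uu; have := corrected_star_close uu; lra.
Qed.

Lemma symmetrized_rep : approx_rep (d / 2) symmetrized.
Proof.
have d0' := d0; have d1' := d1; have L0' := L0.
have h2 := conj_half R.
split.
- exists (7 * L) => [|u v uu uv]; first by lra.
  have -> : symmetrized u - symmetrized v = 2^-1 *: ((corrected u - corrected v) +
      cstar (corrected (cstar u) - corrected (cstar v))).
    by rewrite cstarB /symmetrized; calg.
  rewrite nrmZ half.
  have := nrmD (corrected u - corrected v) (cstar (corrected (cstar u) - corrected (cstar v))).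
  have := corrected_lip uu uv; have := corrected_lip (uS uu) (uS uv).
  by rewrite -cstarB !nrm_star; lra.
- by move=> u uu; rewrite /symmetrized [in RHS]cstarZ [in RHS]cstarD !cstarK h2 addrC.
- have [es _] := pe; have [qs _] := pq.
  rewrite /symmetrized es corrected_unit qs.
  by calg_raw; repeat split; field.
- move=> u uu; have [q1 q2] := corrected_corner uu.
  have [q3 q4] := corrected_corner (uS uu); have [qs _] := pq.
  rewrite /symmetrized -cscaleAr -cscaleAl cmulDl cmulDr q1 q2.
  by split; congr (_ *: (_ + _)); rewrite -{1}qs -cstarM ?q3 ?q4.
- move=> u uu; have := symmetrized_close uu; have := rep_bound rT uu.
  have := nrmB (T u) (T u - symmetrized u); rewrite opprB addrC subrK; lra.
- move=> u v uu uv.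
  pose X := corrected; pose Y t := cstar (corrected (cstar t)).
  have -> : symmetrized (u ** v) - symmetrized u ** symmetrized v =
     2^-1 *: (X (u ** v) - X u ** X v) + 2^-1 *: (Y (u ** v) - Y u ** Y v)
     + (2^-1 * 2^-1) *: ((X u - Y u) ** (X v - Y v)).
    by rewrite /symmetrized -/X -/(Y u) -/(Y v) -/(Y _); calg_raw; repeat split; field.
  have k1 := corrected_defect uu uv.
  have k2 : nrm (Y (u ** v) - Y u ** Y v) <= 6 * d ^+ 2 + d / 4.
    rewrite /Y -cstarM -cstarB nrm_star cstarM.
    exact: corrected_defect (uS uv) (uS uu).
  have XY t : U t -> nrm (X t - Y t) <= 4 * d.
    move=> ut; apply: le_trans (nrm_tri (T t) _ _) _.
    have := corrected_star_close ut; have := corrected_close ut.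
    by rewrite nrm_distC -/(X t) -/(Y t); lra.
  have k3 : nrm ((X u - Y u) ** (X v - Y v)) <= (4 * d) * (4 * d).
    apply: le_trans (nrmM _ _) _.
    by rewrite ler_pM ?nrm_ge0 ?XY.
  apply: le_trans (nrmD _ _) _; rewrite nrmZ cmodM half.
  have := nrmD (2^-1 *: (X (u ** v) - X u ** X v)) (2^-1 *: (Y (u ** v) - Y u ** Y v)).
  rewrite !nrmZ half -/X in k1 *; nra.
Qed.

End Step.

(** The scale of the net is adapted to the Lipschitz constant of [T], which
    grows during the iteration. *)
Theorem approx_rep_improve d T : 0 < d -> d <= 1 / 40 -> approx_rep d T ->
  exists2 T', approx_rep (d / 2) T' & forall u, U u -> nrm (T u - T' u) <= 2 * d.
Proof.
move=> d0 d1 rT; have [L L0 TL] := rep_lip rT.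
have h0 : 0 < d / (4 * (7 * L + 1)) by rewrite divr_gt0 // mulr_gt0 //; lra.
have [m [s [sU sinv]]] := approximate_mean vF eF h0.
exists (symmetrized T s); first exact: (@symmetrized_rep d L).
by move=> u uu; exact: (symmetrized_close d0 rT sU uu).
Qed.

Theorem approx_rep_exact d T : 0 < d -> d <= 1 / 40 -> approx_rep d T ->
  exists2 pi : F -> A, forall u, U u -> nrm (T u - pi u) <= 4 * d &
    (forall u v, U u -> U v -> pi (u ** v) = pi u ** pi v) /\
    (forall u, U u -> pi (cstar u) = cstar (pi u)).
Proof.
move=> d0 d1 rT.
have [t f t0 td rf|pi piT plim] :=
  @geometric_limit R A F (fun u => U u) approx_rep 2 d T d0 (ler0n _ 2) _ rT.
  by apply: approx_rep_improve => //; lra.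
exists pi => [u uu|]; first by have := piT u uu; lra.
have approx t : 0 < t -> exists f, [/\
    forall u v, U u -> U v -> nrm (f (u ** v) - f u ** f v) <= t,
    forall u, U u -> f (cstar u) = cstar (f u),
    forall u, U u -> nrm (f u) <= 2 &
    forall u, U u -> nrm (f u - pi u) <= 4 * t].
  move=> t0; have [d' [f [d'0 d't rf fp]]] := plim t t0.
  exists f; split=> [u v uu uv|u uu|u uu|u uu].
  - exact: le_trans (rep_mul rf uu uv) d't.
  - exact: (rep_star rf uu).
  - by have := rep_bound rf uu; lra.
  - by have := fp u uu; lra.
split=> [u v uu uv|u uu]; apply/subr0_eq.
  apply: (@nrm_small_eq0 _ _ _ 100) => t t0 t1; have [f [fM _ f2 fp]] := approx t t0.
  have -> : pi (u ** v) - pi u ** pi v = (f (u ** v) - f u ** f v)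
      - (f (u ** v) - pi (u ** v)) + (f u ** f v - pi u ** pi v) by calg.
  apply: le_trans (nrmD _ _) _.
  have := nrmB (f (u ** v) - f u ** f v) (f (u ** v) - pi (u ** v)).
  have := nrm_mul_diff (f u) (f v) (pi u) (pi v).
  have := fM _ _ uu uv; have := fp _ (unitaryM eF uu uv).
  have pu : nrm (pi u) <= 6.
    have := nrmB (f u) (f u - pi u); rewrite opprB addrC subrK.
    by have := f2 _ uu; have := fp _ uu; lra.
  have k1 := ler_pM (nrm_ge0 _) (nrm_ge0 _) (fp _ uu) (f2 _ uv).
  have k2 := ler_pM (nrm_ge0 _) (nrm_ge0 _) pu (fp _ uv).
  lra.
apply: (@nrm_small_eq0 _ _ _ 8) => t t0 t1; have [f [_ fs _ fp]] := approx t t0.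
have -> : pi (cstar u) - cstar (pi u) =
    cstar (f u - pi u) - (f (cstar u) - pi (cstar u)).
  by rewrite cstarB fs //; calg.
apply: le_trans (nrmB _ _) _; rewrite nrm_star.
have := fp _ uu; have := fp _ (unitary_star uu); lra.
Qed.

End ApproximateRepresentation.

(** * From an approximate *-homomorphism to a unitary representation *)

Section ApproximateHomomorphism.
Variables (R : realType) (F A : cstarAlgType R) (eps : R) (phi : F -> A).
Hypothesis phiP : approx_star_homomorphism eps phi.
Implicit Types (x y : F) (a : R[i]).

Let unit_ball (V : normedModType R[i]) (x : V) : nrm x <= 1 -> `|x| <= 1.
Proof. by rewrite nrmE -lecR. Qed.

Lemma phi_bounds x y a : nrm x <= 1 -> nrm y <= 1 -> cmod a <= 1 ->
  [/\ nrm (phi (x + y) - phi x - phi y) <= eps,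
      nrm (phi (a *: x) - a *: phi x) <= eps,
      nrm (phi (x ** y) - phi x ** phi y) <= eps,
      nrm (phi (cstar x) - cstar (phi x)) <= eps &
      nrm (phi x) <= 1 + eps].
Proof.
move=> x1 y1 a1.
have a1' : `|a| <= 1 by rewrite cmodE lecR.
have [] := phiP (unit_ball x1) (unit_ball y1) a1'.
have -> : 1 + eps%:C = (1 + eps)%:C :> R[i] by rewrite rmorphD rmorph1.
by rewrite !nrmE !lecR.
Qed.

Let c1 : cmod (1 : R[i]) <= 1. Proof. by rewrite cmod1. Qed.
Let z1 : nrm (0 : F) <= 1. Proof. by rewrite nrm0. Qed.

Lemma phiD_le x y : nrm x <= 1 -> nrm y <= 1 ->
  nrm (phi (x + y) - phi x - phi y) <= eps.
Proof. by move=> x1 y1; have [] := phi_bounds x1 y1 c1. Qed.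

Lemma phiZ_le a x : nrm x <= 1 -> cmod a <= 1 ->
  nrm (phi (a *: x) - a *: phi x) <= eps.
Proof. by move=> x1 a1; have [] := phi_bounds x1 z1 a1. Qed.

Lemma phiM_le x y : nrm x <= 1 -> nrm y <= 1 ->
  nrm (phi (x ** y) - phi x ** phi y) <= eps.
Proof. by move=> x1 y1; have [] := phi_bounds x1 y1 c1. Qed.

Lemma phiS_le x : nrm x <= 1 -> nrm (phi (cstar x) - cstar (phi x)) <= eps.
Proof. by move=> x1; have [] := phi_bounds x1 z1 c1. Qed.

Lemma phi_le x : nrm x <= 1 -> nrm (phi x) <= 1 + eps.
Proof. by move=> x1; have [] := phi_bounds x1 z1 c1. Qed.

Hypothesis eps0 : 0 < eps.
Hypothesis eps1 : eps <= 1.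

(** Almost linearity gives continuity up to [eps]: a vector of norm at most
    [eps] is [eps] times a vector of the unit ball. *)
Lemma phi_close x y : nrm x <= 1 -> nrm y <= 1 -> nrm (x - y) <= eps ->
  nrm (phi x - phi y) <= 4 * eps.
Proof.
move=> x1 y1 xy; pose z := x - y; pose w := (eps^-1)%:C *: z.
have e0 := eps0; have e1 := eps1.
have w1 : nrm w <= 1.
  by rewrite nrmZ cmodR ger0_norm ?invr_ge0 ?(ltW e0) // ler_pdivrMl // mulr1.
have zw : z = eps%:C *: w.
  by rewrite scalerA -rmorphM mulfV ?gt_eqF // scale1r.
have ce : cmod (eps%:C : R[i]) = eps by rewrite cmodR gtr0_norm.
have := @phiZ_le eps%:C w w1; rewrite ce -zw => /(_ e1) hz.
have := @phiD_le y z y1 (le_trans xy e1); rewrite addrCA subrr addr0 => hd.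
have hw := phi_le w1.
have -> : phi x - phi y = (phi x - phi y - phi z) + (phi z - eps%:C *: phi w)
  + eps%:C *: phi w by calg.
apply: le_trans (nrmD _ _) _; rewrite nrmZ ce.
have := nrmD (phi x - phi y - phi z) (phi z - eps%:C *: phi w); nra.
Qed.

Variables (n : nat) (e : F).
Hypothesis vF : inhabited (Vector.axiom n F).
Hypothesis eF : algebra_unit e.
Local Notation U := (unitary e).
Let pe := unit_projection eF.
Let n1 u : U u -> nrm u <= 1 := nrm_unitary pe (u := u).

(** The values of [phi] on a net of unitaries at scale [eps / 2] are
    interpolated with the partition of unity made of the tent functions
    [max(0, eps - |u - x|)]. *)
Lemma lipschitz_approximation : exists2 T : F -> A,
  exists2 L, 0 <= L &
    forall u v, U u -> U v -> nrm (T u - T v) <= L * nrm (u - v) &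
  forall u, U u -> nrm (phi u - T u) <= 4 * eps.
Proof.
have e0 := eps0; have e1 := eps1.
have e2 : 0 < eps / 2 by rewrite divr_gt0.
have [t [tU tnet]] := unitary_net_exists vF eF e2.
pose w x u := Num.max 0 (eps - nrm (u - x)).
pose W u := \sum_(x <- t) w x u.
have w0 x u : 0 <= w x u by rewrite le_max lexx.
have W0 u : U u -> eps / 2 <= W u.
  move=> /tnet[x xt ux]; rewrite /W (big_rem x) //=.
  apply: ler_wpDr; first by apply: sumr_ge0.
  by rewrite le_max; apply/orP; right; lra.
have wL x u v : `|w x u - w x v| <= nrm (u - v).
  have h1 := nrm_tri v u x; have h2 := nrm_tri u v x.
  have := nrm_ge0 (u - v); rewrite (nrm_distC v u) in h2 * => h3.
  rewrite /w; case: (leP 0 (eps - nrm (u - x))) => h4;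
    case: (leP 0 (eps - nrm (v - x))) => h5; rewrite ler_norml; lra.
pose N : R := (size t)%:R.
have WL u v : `|W u - W v| <= N * nrm (u - v).
  rewrite /W -sumrB; apply: le_trans (ler_norm_sum _ _ _) _.
  apply: (@le_trans _ _ (\sum_(x <- t) nrm (u - v))).
    by apply: ler_sum => x _; exact: wL.
  by rewrite big_const_seq count_predT iter_addr_0 -mulr_natl.
have wW x u : x \in t -> w x u <= W u.
  move=> xt; rewrite /W (big_rem x) //=; apply: ler_wpDr => //.
  by apply: sumr_ge0.
pose T u := \sum_(x <- t) (w x u / W u)%:C *: phi x.
exists T.
  exists (N * (2 * ((1 + N) * (2 / eps)))).
    by rewrite !mulr_ge0 ?addr_ge0 ?invr_ge0 ?ler0n // ltW.
  move=> u v uu uv; pose r := nrm (u - v).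
  have Wu := W0 u uu; have Wv := W0 v uv.
  have Wup : 0 < W u by lra.
  have Wvp : 0 < W v by lra.
    (* Writing the difference over the denominator [W u], which is at least [eps
      / 2], and using that [w x v / W v] is at most [1]. *)
have coef x : x \in t -> `|w x u / W u - w x v / W v| <= (1 + N) * (2 / eps) * r.
    move=> xt.
    have -> : w x u / W u - w x v / W v =
        ((w x u - w x v) + (w x v / W v) * (W v - W u)) / W u.
      by field; rewrite !gt_eqF.
    rewrite normrM normfV (gtr0_norm Wup) ler_pdivrMr //.
    apply: (@le_trans _ _ ((1 + N) * r)).
      apply: le_trans (ler_normD _ _) _.
      rewrite mulrDl mul1r; apply: lerD; first exact: wL.
      rewrite normrM -[leRHS]mul1r; apply: ler_pM => //; last first.
        by rewrite distrC; exact: WL.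
      by rewrite ger0_norm ?divr_ge0 ?(ltW Wvp) // ler_pdivrMr // mul1r wW.
    have -> : (1 + N) * (2 / eps) * r * W u = (1 + N) * r * (W u / (eps / 2)).
      by field; rewrite gt_eqF.
    rewrite ler_peMr //; last by rewrite ler_pdivlMr // mul1r.
    by rewrite mulr_ge0 ?nrm_ge0 // addr_ge0 ?ler0n.
  have -> : T u - T v = \sum_(x <- t) (w x u / W u - w x v / W v)%:C *: phi x.
    by rewrite /T -sumrB; apply: eq_bigr => x _; rewrite rmorphB scalerBl.
  apply: le_trans (nrm_sum _ _ _) _.
  apply: (@le_trans _ _ (\sum_(x <- t) (2 * ((1 + N) * (2 / eps)) * r))).
    rewrite big_seq [leRHS]big_seq; apply: ler_sum => x xt.
    rewrite nrmZ cmodR; have := coef x xt.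
    have h := phi_le (n1 (tU x xt)); have h' : nrm (phi x) <= 2 by lra.
    move=> hc; have := ler_pM (normr_ge0 _) (nrm_ge0 _) hc h'; lra.
  by rewrite big_const_seq count_predT iter_addr_0 -[_ *+ size t]mulr_natl -/N mulrA.
move=> u uu; have Wu := W0 u uu; have Wup : 0 < W u by lra.
have sum1 : \sum_(x <- t) w x u / W u = 1.
  by rewrite -mulr_suml mulfV // gt_eqF.
have -> : phi u - T u = \sum_(x <- t) (w x u / W u)%:C *: (phi u - phi x).
  under [RHS]eq_bigr => x _ do rewrite scalerBr.
  by rewrite sumrB -scaler_suml -rmorph_sum sum1 scale1r.
apply: le_trans (nrm_sum _ _ _) _.
apply: (@le_trans _ _ (\sum_(x <- t) (w x u / W u * (4 * eps)))); last first.
  by rewrite -mulr_suml sum1 mul1r.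
rewrite big_seq [leRHS]big_seq; apply: ler_sum => x xt.
rewrite nrmZ cmodR ger0_norm ?divr_ge0 ?(ltW Wup) //.
have [ux|ux] := leP (nrm (u - x)) eps.
  rewrite ler_wpM2l ?divr_ge0 ?(ltW Wup) //.
  by apply: phi_close => //; apply: n1 => //; exact: tU.
by rewrite /w (_ : Num.max 0 _ = 0) ?mul0r //; apply/max_idPl; lra.
Qed.

Hypothesis eps_small : 1000 * (1000 * eps) <= 1.

(** The Lipschitz approximation is symmetrized; its value [h] at the unit is
    then almost a projection, and [q] is the projection near it. The
    compression [q T2(u) q] is shifted by the constant [q - q h q] so that the
    unit is sent exactly to [q]. *)
Theorem initial_rep : exists q T, [/\ projection q,
  approx_rep e q (2500 * eps) T &
  forall u, U u -> nrm (phi u - T u) <= 600 * eps].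
Proof.
have e0 := eps0; have e6 := eps_small.
have [T1 [L L0 T1L] T1phi] := lipschitz_approximation.
have half := cmod_half R; have h2 := conj_half R.
have uS u : U u -> U (cstar u) := @unitary_star _ _ e u.
pose T2 u := 2^-1 *: (T1 u + cstar (T1 (cstar u))).
have T2L u v : U u -> U v -> nrm (T2 u - T2 v) <= L * nrm (u - v).
  move=> uu uv; have -> : T2 u - T2 v = 2^-1 *: ((T1 u - T1 v) +
      cstar (T1 (cstar u) - T1 (cstar v))) by rewrite cstarB /T2; calg.
  rewrite nrmZ half; have := T1L _ _ uu uv; have := T1L _ _ (uS _ uu) (uS _ uv).
  rewrite -cstarB nrm_star => k1 k2.
  have := nrmD (T1 u - T1 v) (cstar (T1 (cstar u) - T1 (cstar v))).
  rewrite nrm_star; lra.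
have T2S u : T2 (cstar u) = cstar (T2 u).
  by rewrite /T2 cstarZ cstarD !cstarK h2 addrC.
have T2phi u : U u -> nrm (phi u - T2 u) <= 5 * eps.
  move=> uu; have -> : phi u - T2 u = 2^-1 *: ((phi u - T1 u) +
      ((phi u - cstar (phi (cstar u))) + cstar (phi (cstar u) - T1 (cstar u)))).
    by rewrite cstarB /T2; calg_raw; repeat split; field.
  rewrite nrmZ half.
  have := nrmD (phi u - T1 u)
    ((phi u - cstar (phi (cstar u))) + cstar (phi (cstar u) - T1 (cstar u))).
  have := nrmD (phi u - cstar (phi (cstar u))) (cstar (phi (cstar u) - T1 (cstar u))).
  have := phiS_le (n1 (uS _ uu)); rewrite cstarK nrm_star.
  have := T1phi _ uu; have := T1phi _ (uS _ uu); lra.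
pose f := phi e; pose h := T2 e.
have ue := unitary1 pe.
have [es _] := pe.
have sh : cstar h = h by rewrite /h -T2S es.
have f1 : nrm f <= 1 + eps := phi_le (n1 ue).
have fh : nrm (f - h) <= 5 * eps := T2phi _ ue.
have nT2 u : U u -> nrm (T2 u) <= 1 + 6 * eps.
  move=> uu; have := T2phi _ uu; have := phi_le (n1 uu).
  by have := nrmB (phi u) (phi u - T2 u); rewrite opprB addrC subrK; lra.
have h1 := nT2 _ ue; rewrite -/h in h1.
have hh : nrm (h ** h - h) <= 17 * eps.
  have -> : h ** h - h = (f - h) - (f - f ** f) - (f ** f - h ** h) by calg.
  have k1 := phiM_le (n1 ue) (n1 ue); rewrite (mul_e_x eF) -/f in k1.
  have k2 := nrm_mul_diff f f h h.
  have k3 := nrmB ((f - h) - (f - f ** f)) (f ** f - h ** h).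
  have k4 := nrmB (f - h) (f - f ** f).
  have := nrm_ge0 (f - h); have := nrm_ge0 h; have := nrm_ge0 f; nra.
have [||||| q pq hq] := @projection_near R A h (17 * eps) => //; try lra.
exists q.
pose T u := q ** T2 u ** q + (q - q ** h ** q).
exists T.
have [qs qq] := pq; have q1 := nrm_projection_le1 pq.
have fq : nrm (f - q) <= 175 * eps.
  by have := nrm_tri h f q; lra.
have Tphi u : U u -> nrm (phi u - T u) <= 600 * eps.
  move=> uu; pose a := phi u.
  have -> : a - T u = (a - f ** a) + f ** (a - a ** f)
      + (f ** (a ** f) - q ** (T2 u ** q)) - q ** (q - h) ** q.
    have -> : q ** (q - h) ** q = q - q ** h ** q.
      by rewrite cmulBr cmulBl !qq.
    by rewrite /T; calg.
  have a1 : nrm a <= 1 + eps := phi_le (n1 uu).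
  have k1 := phiM_le (n1 ue) (n1 uu); rewrite (mul_e_x eF) -/f -/a in k1.
  have k2 := phiM_le (n1 uu) (n1 ue); rewrite (mul_x_e eF) -/f -/a in k2.
  have k3 : nrm (f ** (a - a ** f)) <= 2 * eps.
    apply: le_trans (nrmM _ _) _.
    by apply: ler_pM; rewrite ?nrm_ge0 //; lra.
  have k4 := nrm_mul_diff f (a ** f) q (T2 u ** q).
  have k5 := nrm_mul_diff a f (T2 u) q.
  have k6 : nrm (a ** f) <= (1 + eps) * (1 + eps).
    by apply: le_trans (nrmM _ _) _; rewrite ler_pM ?nrm_ge0.
  have k7 : nrm (q ** (q - h) ** q) <= 170 * eps.
    apply: le_trans (nrmM _ _) _; have k8 := nrmM q (q - h).
    rewrite (nrm_distC q h) in k8.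
    have := nrm_ge0 (q ** (q - h)); have := nrm_ge0 (h - q).
    have := nrm_ge0 q; nra.
  have k9 := T2phi _ uu; rewrite -/a in k9; have k10 := nT2 _ uu.
  have k11 : nrm (a ** f - T2 u ** q) <= 190 * eps.
    have l1 := ler_pM (nrm_ge0 _) (nrm_ge0 _) k9 f1.
    have l2 := ler_pM (nrm_ge0 _) (nrm_ge0 _) k10 fq.
    nra.
  have k12 : nrm (f ** (a ** f) - q ** (T2 u ** q)) <= 400 * eps.
    have l1 := ler_pM (nrm_ge0 _) (nrm_ge0 _) fq k6.
    have l2 := ler_pM (nrm_ge0 _) (nrm_ge0 _) q1 k11.
    nra.
  have := nrmB ((a - f ** a) + f ** (a - a ** f)
      + (f ** (a ** f) - q ** (T2 u ** q))) (q ** (q - h) ** q).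
  have := nrmD ((a - f ** a) + f ** (a - a ** f))
      (f ** (a ** f) - q ** (T2 u ** q)).
  have := nrmD (a - f ** a) (f ** (a - a ** f)); lra.
have nT u : U u -> nrm (T u) <= 1 + 601 * eps.
  move=> uu; have := Tphi _ uu; have := phi_le (n1 uu).
  by have := nrmB (phi u) (phi u - T u); rewrite opprB addrC subrK; lra.
split=> //; split.
- exists L => // u v uu uv.
  have -> : T u - T v = q ** (T2 u - T2 v) ** q by rewrite /T; calg.
  have := nrmM (q ** (T2 u - T2 v)) q; have := nrmM q (T2 u - T2 v).
  have := T2L _ _ uu uv; have := nrm_ge0 (q ** (T2 u - T2 v)).
  have := nrm_ge0 (T2 u - T2 v); have := nrm_ge0 q; nra.
- move=> u uu; rewrite /T T2S.
  have sw (x : A) : cstar (q ** x ** q) = q ** cstar x ** q.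
    by rewrite !cstarM qs cmulA.
  by rewrite cstarD cstarB !sw qs sh.
- by rewrite /T addrCA subrr addr0.
- move=> u uu; rewrite /T cmulDl cmulDr cmulBl cmulBr.
  by rewrite -!cmulA qq !(cmulA q q) qq.
- by move=> u uu; have := nT u uu; lra.
- move=> u v uu uv; have uuv := unitaryM eF uu uv.
  have -> : T (u ** v) - T u ** T v = (phi (u ** v) - phi u ** phi v)
     - (phi (u ** v) - T (u ** v)) + (phi u ** phi v - T u ** T v) by calg.
  have k1 := phiM_le (n1 uu) (n1 uv); have k2 := Tphi _ uuv.
  have k3 := nrm_mul_diff (phi u) (phi v) (T u) (T v).
  have k4 := ler_pM (nrm_ge0 _) (nrm_ge0 _) (Tphi _ uu) (phi_le (n1 uv)).
  have k5 := ler_pM (nrm_ge0 _) (nrm_ge0 _) (nT _ uu) (Tphi _ uv).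
  have := nrmD ((phi (u ** v) - phi u ** phi v) - (phi (u ** v) - T (u ** v)))
    (phi u ** phi v - T u ** T v).
  have := nrmB (phi (u ** v) - phi u ** phi v) (phi (u ** v) - T (u ** v)).
  nra.
Qed.

Theorem near_unitary_rep : exists2 pi : F -> A,
  forall u, U u -> nrm (phi u - pi u) <= 100 * (106 * eps) &
  (forall u v, U u -> U v -> pi (u ** v) = pi u ** pi v) /\
  (forall u, U u -> pi (cstar u) = cstar (pi u)).
Proof.
have e0 := eps0; have e6 := eps_small.
have [q [T [pq rT Tphi]]] := initial_rep.
have [|| pi Tpi piP] := approx_rep_exact vF eF pq _ _ rT; try lra.
exists pi => // u uu; have := nrm_tri (T u) (phi u) (pi u).
have := Tphi u uu; have := Tpi u uu; lra.
Qed.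

End ApproximateHomomorphism.

(** * Circle homomorphisms and curves of unitaries *)

Section Curves.
Variable R : realType.
Local Notation C := R[i].

(** With [x = g l - q] one has [g (l l) - q = 2 x + x^2], so squaring the
    argument expands distances by a factor of at least [3 / 2] while they
    remain at most [1 / 2]. *)
Lemma no_small_subgroup (A : cstarAlgType R) (q : A) (g : C -> A) :
  projection q -> (forall l, cmod l = 1 -> q ** g l = g l /\ g l ** q = g l) ->
  (forall l, cmod l = 1 -> g (l * l) = g l ** g l) ->
  (forall l, cmod l = 1 -> nrm (g l - q) <= 1 / 2) ->
  forall l, cmod l = 1 -> g l = q.
Proof.
move=> [_ qq] gq gM g2.
have grow l : cmod l = 1 -> 3 / 2 * nrm (g l - q) <= nrm (g (l * l) - q).
  move=> l1; have [q1 q2] := gq l l1; have h := g2 l l1.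
  have E : 2 *: (g l - q) = (g (l * l) - q) - (g l - q) ** (g l - q).
    rewrite gM //; transitivity (2 *: g l - 2 *: q); first by calg.
    have -> : (g l - q) ** (g l - q) = g l ** g l - (q ** g l) - (g l ** q) + q ** q.
      by calg.
    by rewrite q1 q2 qq; calg.
  have := nrmB (g (l * l) - q) ((g l - q) ** (g l - q)).
  have := nrmM (g l - q) (g l - q); have := nrm_ge0 (g l - q).
  rewrite -E nrmZ cmod_nat; nra.
have ll (l : C) : cmod l = 1 -> cmod (l * l) = 1 by move=> l1; rewrite cmodM l1 mulr1.
have half l : cmod l = 1 -> nrm (g l - q) <= 2^-1 * nrm (g ((l * l) * (l * l)) - q).
  by move=> l1; have := grow l l1; have := grow _ (ll _ l1); have := nrm_ge0 (g l - q); lra.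
have pow k l : cmod l = 1 -> nrm (g l - q) <= 1 / 2 * 2^-1 ^+ k.
  elim: k l => [|k IH] l l1; first by rewrite mulr1; exact: g2.
  have := IH _ (ll _ (ll _ l1)); have := half l l1; rewrite exprS; lra.
move=> l l1; apply/subr0_eq; apply: (@nrm_small_eq0 _ _ _ 1) => t t0 _.
have [k kt] := geometric_small (divr_gt0 ltr01 (ltr0n _ 2) : 0 < 1 / 2 :> R) t0.
by rewrite mul1r; exact: le_trans (pow k l l1) kt.
Qed.

(** A point of the unit circle, up to second order equal to [1 + i x]. *)
Definition circle_pt (x : R) : C := Num.sqrt (1 - x ^+ 2) +i* x.

Lemma cmod_circle_pt x : `|x| <= 1 -> cmod (circle_pt x) = 1.
Proof.
move=> x1; rewrite /cmod /circle_pt /= sqr_sqrtr ?subrK ?sqrtr1 //.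
by rewrite subr_ge0 -(real_normK (num_real _)) exprn_ile1 ?normr_ge0.
Qed.

Lemma circle_pt_expand x : `|x| <= 1 ->
  cmod (circle_pt x - 1 - 'i%C * x%:C) <= x ^+ 2.
Proof.
move=> x1.
have x2 : x ^+ 2 <= 1.
  by rewrite -(real_normK (num_real _)) exprn_ile1 ?normr_ge0.
have -> : circle_pt x - 1 - 'i%C * x%:C = (Num.sqrt (1 - x ^+ 2) - 1)%:C.
  by apply/eqP; rewrite eq_complex /circle_pt /=; apply/andP; split; apply/eqP; lra.
rewrite cmodR; set s := Num.sqrt _.
have s0 : 0 <= s by exact: sqrtr_ge0.
have ss : s * s = 1 - x ^+ 2 by rewrite -expr2 sqr_sqrtr // subr_ge0.
have xx : 0 <= x ^+ 2 by exact: sqr_ge0.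
have s1 : s <= 1 by rewrite leNgt; apply/negP => s1; nra.
rewrite ler_norml; nra.
Qed.

Section Curve.
Variables (A : cstarAlgType R) (e : A).
Hypothesis pe : projection e.

Definition curve (t : R) (s : seq (R * A)) : A :=
  foldr (fun z v => twist e (circle_pt (t * z.1)) z.2 ** v) e s.

Definition tangent (s : seq (R * A)) : A := \sum_(z <- s) z.1%:C *: z.2.

(** To first order a product of elements close to the unit is a sum. The
    smallness condition on [t] keeps the values of [circle_pt] on the circle.
    *)
Lemma curve_expand s : (forall z, z \in s -> below e z.2) ->
  exists2 K, 0 <= K & exists2 t0, 0 < t0 <= 1 & forall t, 0 < t -> t <= t0 ->
    (forall z, z \in s -> `|t * z.1| <= 1) /\
    nrm (curve t s - e - ('i%C * t%:C) *: tangent s) <= K * t ^+ 2.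
Proof.
elim: s => [|[a p] s IH] bs.
  exists 0 => //; exists 1; rewrite ?ltr01 ?lexx // => t t0 t1; split=> //.
  by rewrite /curve /tangent big_nil /= scaler0 subrr subr0 nrm0 mul0r.
have [z zs|K K0 [t0 /andP[t00 t01] ht]] := IH; first by apply: bs; rewrite inE zs orbT.
have [[_ pp] ep pe'] : below e p by apply: (bs (a, p)); rewrite inE eqxx.
have p1 : nrm p <= 1.
  by have [pr _ _] : below e p := bs (a, p) (mem_head _ _); exact: nrm_projection_le1.
have a0 := normr_ge0 a; have X0 := nrm_ge0 (tangent s).
pose a2 := `|a| ^+ 2; have a20 : 0 <= a2 by rewrite sqr_ge0.
exists (K + a2 + (`|a| + a2) * (nrm (tangent s) + K)).
  by rewrite !addr_ge0 ?mulr_ge0 ?addr_ge0.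
pose t1 := Num.min t0 (`|a| + 1)^-1.
have a1 : 0 < `|a| + 1 by rewrite ltr_wpDl.
exists t1.
  by rewrite lt_min t00 invr_gt0 a1 ge_min t01.
move=> t tp; rewrite le_min => /andP[tt0 ta].
have [ht1 ht2] := ht t tp tt0.
have tle : t <= 1 by lra.
have ta1 : `|t * a| <= 1.
  rewrite normrM (gtr0_norm tp); move: ta.
  rewrite -[_^-1]mul1r ler_pdivlMr // mulrDr mulr1; lra.
split.
  by move=> z; rewrite inE => /orP[/eqP -> //|]; exact: ht1.
rewrite /tangent big_cons /= -/(tangent s) -/(curve t s).
set X := tangent s in ht2 X0 *; set v := curve t s in ht2 *.
set c := circle_pt (t * a); pose rho := c - 1 - 'i%C * (t * a)%:C.
pose r := v - e - ('i%C * t%:C) *: X.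
have vE : v = e + ('i%C * t%:C) *: X + r by rewrite /r; calg.
have ev : e ** v = v.
  have : forall s', (forall z, z \in s' -> below e z.2) -> e ** curve t s' = curve t s'.
    case=> [|[b p'] s'] bs' /=; first by case: pe.
    rewrite cmulA; congr (_ ** _); rewrite /twist cmulDr -cscaleAr.
    by case: pe => _ ->; have [_ -> _] := bs' (b, p') (mem_head _ _).
  by apply=> z zs; apply: bs; rewrite inE zs orbT.
have -> : twist e c p ** v - e - ('i%C * t%:C) *: (a%:C *: p + X) =
    r + rho *: p + (c - 1) *: (('i%C * t%:C) *: (p ** X) + p ** r).
  rewrite /twist cmulDl ev -cscaleAl {2}vE !cmulDr pe' {1}vE /rho rmorphM /=.
  by calg.
have rhole : cmod rho <= a2 * t ^+ 2.
  apply: le_trans (circle_pt_expand ta1) _.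
  by rewrite exprMn /a2 real_normK ?num_real // mulrC.
have cle : cmod (c - 1) <= (`|a| + a2) * t.
  have -> : c - 1 = rho + 'i%C * (t * a)%:C by rewrite /rho subrK.
  apply: le_trans (cmodD _ _) _; rewrite cmodM cmodi cmodR normrM (gtr0_norm tp).
  have : a2 * t ^+ 2 <= a2 * t by rewrite ler_wpM2l // expr2 ler_piMr // ltW.
  lra.
have rle : nrm r <= K * t ^+ 2 by exact: ht2.
have t2 : t ^+ 2 <= t by rewrite expr2 ler_piMr // ltW.
have tg0 : 0 <= t ^+ 2 by exact: sqr_ge0.
have h1 : nrm (rho *: p) <= a2 * t ^+ 2.
  by rewrite nrmZ -[leRHS]mulr1 ler_pM ?cmod_ge0 ?nrm_ge0.
have h2 : nrm (('i%C * t%:C) *: (p ** X) + p ** r) <= t * (nrm X + K).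
  apply: le_trans (nrmD _ _) _; rewrite nrmZ cmodM cmodi cmodR (gtr0_norm tp).
  have k1 : nrm (p ** X) <= nrm X.
    by apply: le_trans (nrmM _ _) _; rewrite ler_piMl.
  have k2 : nrm (p ** r) <= nrm r.
    by apply: le_trans (nrmM _ _) _; rewrite ler_piMl ?nrm_ge0.
  have k3 : K * t ^+ 2 <= K * t by rewrite ler_wpM2l.
  have k4 : t * nrm (p ** X) <= t * nrm X by rewrite ler_wpM2l // ltW.
  lra.
have h3 := ler_pM (cmod_ge0 _) (nrm_ge0 _) cle h2.
apply: le_trans (nrmD _ _) _; rewrite [in X in _ + X <= _]nrmZ.
have := nrmD r (rho *: p).
have -> : (K + a2 + (`|a| + a2) * (nrm X + K)) * t ^+ 2 =
  K * t ^+ 2 + a2 * t ^+ 2 + (`|a| + a2) * t * (t * (nrm X + K)) by ring.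
lra.
Qed.

End Curve.
End Curves.

(** * Extension of a unitary representation to a *-homomorphism *)

Section Extension.
Variables (R : realType) (F A : cstarAlgType R) (eps kappa : R).
Variables (phi pi : F -> A) (n : nat) (e : F).
Hypothesis phiP : approx_star_homomorphism eps phi.
Hypothesis vF : inhabited (Vector.axiom n F).
Hypothesis eF : algebra_unit e.
Local Notation C := R[i].
Local Notation U := (unitary e).
Hypothesis phi_pi : forall u, U u -> nrm (phi u - pi u) <= kappa.
Hypothesis piM : forall u v, U u -> U v -> pi (u ** v) = pi u ** pi v.
Hypothesis piS : forall u, U u -> pi (cstar u) = cstar (pi u).
Hypothesis eps0 : 0 < eps.
Hypothesis small : 4 * kappa + 8 * eps <= 1 / 2.

Let pe := unit_projection eF.
Let ue := unitary1 pe.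
Let n1 u : U u -> nrm u <= 1 := nrm_unitary pe (u := u).
Let bp p : projection p -> below e p := below_unit eF (p := p).
Let tU l p : projection p -> cmod l = 1 -> U (twist e l p).
Proof. by move=> pp l1; apply: twist_unitary => //; exact: bp. Qed.
Let cN1 : cmod (-1 : C) = 1. Proof. by rewrite cmodN cmod1. Qed.
Let cJ (l : C) : cmod l = 1 -> cmod (Num.conj l) = 1.
Proof. by rewrite cmodJ. Qed.

Let q := pi e.

Lemma q_projection : projection q.
Proof.
have [es ee] := pe; split; first by rewrite /q -piS // es.
by rewrite /q -piM // ee.
Qed.

Lemma q_corner u : U u -> q ** pi u = pi u /\ pi u ** q = pi u.
Proof. by move=> uu; rewrite /q -!piM // (mul_e_x eF) (mul_x_e eF). Qed.

(** The image of the symmetry [e - 2 p] determines a projection. *)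
Definition psi0 p := 2^-1 *: (q - pi (twist e (-1) p)).

Lemma psi0_below p : projection p -> below q (psi0 p).
Proof.
move=> pp; have uv := tU pp cN1; have [q1 q2] := q_corner uv.
have [qs qq] := q_projection.
set v := pi (twist e (-1) p) in q1 q2 *.
have vv : v ** v = q.
  by rewrite /v -piM // twistM // ?mulrNN ?mulr1 ?twist1 //; exact: bp.
have vs : cstar v = v.
  rewrite /v -piS //; congr pi; rewrite twist_star //.
  by rewrite rmorphN rmorph1.
have h2 := conj_half R.
have e1 : q ** psi0 p = psi0 p.
  by rewrite /psi0 -cscaleAr cmulBr qq q1.
split=> //; last by rewrite /psi0 -cscaleAl cmulBl qq q2.
split; first by rewrite /psi0 cstarZ cstarB qs -/v vs h2.
have -> : psi0 p ** psi0 p = (2^-1 * 2^-1) *: (q ** q - q ** v - (v ** q - v ** v)).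
  by rewrite /psi0 -/v; calg.
rewrite qq q1 q2 vv /psi0 -/v.
by calg_raw; repeat split; field.
Qed.

Lemma psi0_projection p : projection p -> projection (psi0 p).
Proof. by case/psi0_below. Qed.

(** Up to a few [eps], [phi (e - 2 p)] is [phi e - 2 phi p]. *)
Lemma psi0_close p : projection p -> nrm (psi0 p - phi p) <= kappa + 2 * eps.
Proof.
move=> pp; have uv := tU pp cN1; have p1 := nrm_projection_le1 pp.
have n1p : nrm (- p) <= 1 by rewrite nrmN.
have pep := projection_complement eF pp.
have h1 := phiD_le phiP (nrm_projection_le1 pep) n1p.
have h2 := phiD_le phiP (n1 ue) n1p.
have h3 := @phiZ_le _ _ _ _ _ phiP (-1) p p1 _.
rewrite cN1 !scaleN1r in h3; have {}h3 := h3 (lexx _).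
have h4 := phi_pi uv; have h5 := phi_pi ue.
have te : e - p - p = twist e (-1) p by rewrite /twist; calg.
rewrite te in h1.
have -> : psi0 p - phi p = 2^-1 *: ((phi (twist e (-1) p) - pi (twist e (-1) p))
   - (phi e - pi e) - (phi (twist e (-1) p) - phi (e - p) - phi (- p))
   - (phi (e - p) - phi e - phi (- p))
   - 2 *: (phi (- p) + phi p)).
  by rewrite /psi0 /q; calg_raw; repeat split; field.
rewrite nrmZ cmod_half.
set a1 := phi (twist _ _ _) - pi _ in h4 *; set a2 := phi e - pi e in h5 *.
set a3 := phi (twist _ _ _) - _ - _ in h1 *; set a4 := phi (e - p) - _ - _ in h2 *.
have h3' : nrm (phi (- p) + phi p) <= eps by rewrite opprK in h3.
have := nrmB (a1 - a2 - a3 - a4) (2 *: (phi (- p) + phi p)).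
rewrite nrmZ cmod_nat.
have := nrmB (a1 - a2 - a3) a4; have := nrmB (a1 - a2) a3; have := nrmB a1 a2.
lra.
Qed.

(** The product [g] of [pi (twist e m p)] with the adjoint of [twist q m (psi0
    p)] is multiplicative in [m], because [psi0 p] is a combination of values
    of [pi] at elements that commute; it remains close to [q], hence it is
    constant. *)
Lemma pi_twist l p : projection p -> cmod l = 1 ->
  pi (twist e l p) = twist q l (psi0 p).
Proof.
move=> pp.
have pq := q_projection; have [qs qq] := pq.
have bq := psi0_below pp; have [pr qp pq'] := bq.
pose s l := pi (twist e l p); pose t l := twist q l (psi0 p).
have uT m : cmod m = 1 -> U (twist e m p) by exact: tU.
have sM m m' : cmod m = 1 -> cmod m' = 1 -> s m ** s m' = s (m * m').
  move=> h h'; rewrite /s -piM; [|exact: uT|exact: uT].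
  by rewrite twistM //; exact: bp.
have tM m m' : t m ** t m' = t (m * m') by exact: twistM.
have st m m' : cmod m = 1 -> s m ** t m' = t m' ** s m.
  move=> h; have [q1 q2] := q_corner (uT _ h).
  rewrite /t /twist /psi0 -/(s (-1)) cmulDl cmulDr -!cscaleAl -!cscaleAr.
  rewrite cmulBl cmulBr -/(s m) in q1 q2 *.
  by rewrite -/(s m) in q1 q2 *; rewrite q1 q2 !sM // mulrC.
have nt m : cmod m = 1 -> nrm (t m) <= 1.
  by move=> h; apply: (nrm_unitary pq); exact: twist_unitary.
have near m : cmod m = 1 -> nrm (s m - t m) <= 4 * kappa + 8 * eps.
  move=> h; have k1 := phi_pi (uT _ h).
  have k2 := psi0_close pp; have k3 := phi_pi ue.
  have p1 := nrm_projection_le1 pp; have n1p : nrm (- p) <= 1 by rewrite nrmN.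
  have k4 := phiD_le phiP (n1 ue) n1p.
  have k5 := @phiZ_le _ _ _ _ _ phiP (-1) p p1 _.
  rewrite cN1 !scaleN1r opprK in k5; have {}k5 := k5 (lexx _).
  have k6 := @phiZ_le _ _ _ _ _ phiP m p p1 _.
  rewrite h in k6; have {}k6 := k6 (lexx _).
  have pep := projection_complement eF pp.
  have nmp : nrm (m *: p) <= 1 by rewrite nrmZ h mul1r.
  have k7 := phiD_le phiP nmp (nrm_projection_le1 pep).
  have te : m *: p + (e - p) = twist e m p by rewrite /twist; calg.
  rewrite te in k7.
  have -> : s m - t m = (phi (twist e m p) - phi (m *: p) - phi (e - p))
     - (phi (twist e m p) - pi (twist e m p)) + (phi (m *: p) - m *: phi p)
     + (phi (e - p) - phi e - phi (- p)) + (phi (- p) + phi p)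
     + (phi e - pi e) - m *: (psi0 p - phi p) + (psi0 p - phi p).
    by rewrite /s /t /twist -/q; calg.
  have k8 : nrm (m *: (psi0 p - phi p)) <= kappa + 2 * eps.
    by rewrite nrmZ h mul1r.
  set a1 := phi (twist _ _ _) - _ - _ in k7 *; set a2 := phi (twist _ _ _) - _ in k1 *.
  set a3 := phi (m *: p) - _ in k6 *; set a4 := phi (e - p) - _ - _ in k4 *.
  set a5 := phi (- p) + _ in k5 *; set a6 := phi e - _ in k3 *.
  set a7 := m *: _ in k8 *; set a8 := psi0 p - _ in k2 *.
  have := nrmD (a1 - a2 + a3 + a4 + a5 + a6 - a7) a8.
  have := nrmB (a1 - a2 + a3 + a4 + a5 + a6) a7.
  have := nrmD (a1 - a2 + a3 + a4 + a5) a6.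
  have := nrmD (a1 - a2 + a3 + a4) a5.
  have := nrmD (a1 - a2 + a3) a4; have := nrmD (a1 - a2) a3; have := nrmB a1 a2.
  have := eps0; lra.
pose g m := s m ** t (Num.conj m).
have gq : forall m, cmod m = 1 -> g m = q.
  apply: (no_small_subgroup pq) => m h.
  - have [q1 q2] := q_corner (uT _ h); rewrite /g cmulA q1; split=> //.
    by rewrite -cmulA; congr (_ ** _); rewrite /t /twist cmulDl qq -cscaleAl pq'.
  - rewrite /g rmorphM -sM // -tM !cmulA; congr (_ ** _).
    by rewrite -!cmulA; congr (_ ** _); rewrite st.
  - have -> : g m - q = (s m - t m) ** t (Num.conj m).
      by rewrite cmulBl tM mulCJ // /t twist1.
    apply: le_trans (nrmM _ _) _; have := near m h; have := nt _ (cJ h).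
    have := nrm_ge0 (s m - t m); have := nrm_ge0 (t (Num.conj m)).
    have := small; nra.
move=> l1; have [q1 q2] := q_corner (uT _ l1).
rewrite -/(s l) -/(t l) -[s l]q2 -/(s l).
have -> : q = t (Num.conj l) ** t l by rewrite tM mulrC mulCJ // /t twist1.
rewrite cmulA -/(g l) gq // /t /twist cmulDr qq -cscaleAr.
by rewrite qp.
Qed.

Lemma twist_orth (B : cstarAlgType R) (f : B) l p p' : f ** f = f ->
  f ** p' = p' -> p ** f = p -> p ** p' = 0 ->
  twist f l p ** twist f l p' = twist f l (p + p').
Proof.
move=> ff fp pf pp'; rewrite /twist cmulDl !cmulDr -!cscaleAl -!cscaleAr.
by rewrite ff fp pf pp' !scaler0 addr0 scalerDr -addrA [_ *: p' + _]addrC.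
Qed.

(** With [a], [b], [s] the images of [p], [p'] and [p + p'], comparing the
    values of [pi] at the twists gives [s = a + b + (l - 1) a b] for every [l]
    on the circle. The values [-1] and ['i] of [l] force [a b = 0]. *)
Lemma psi0_orth p p' : projection p -> projection p' -> p ** p' = 0 ->
  psi0 p ** psi0 p' = 0.
Proof.
move=> hp hp' pp'; have [[_ ee] [_ qq]] := (pe, q_projection).
have p'p : p' ** p = 0.
  by have [[ps _] [ps' _]] := (hp, hp'); rewrite -ps -ps' -cstarM pp' cstar0.
have hs : projection (p + p').
  have [[ps pp] [ps' pp2]] := (hp, hp'); split; first by rewrite cstarD ps ps'.
  by rewrite cmulDl !cmulDr pp pp2 pp' p'p add0r addr0.
have [[_ ap pa] [_ bp' pb]] := (psi0_below hp, psi0_below hp').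
set a := psi0 p in ap pa *; set b := psi0 p' in bp' pb *; set s := psi0 (p + p').
have key l : cmod l = 1 -> (l - 1) *: s = (l - 1) *: (a + b) + ((l - 1) * (l - 1)) *: (a ** b).
  move=> l1; have := pi_twist hs l1.
  rewrite -twist_orth ?(mul_e_x eF) ?(mul_x_e eF) // piM; [|exact: tU|exact: tU].
  have gen (x y : A) : q ** y = y -> x ** q = x -> twist q l x ** twist q l y =
      q + ((l - 1) *: (x + y) + ((l - 1) * (l - 1)) *: (x ** y)).
    move=> qy xq; rewrite /twist cmulDl !cmulDr -!cscaleAl -!cscaleAr qq qy xq.
    by calg.
  by rewrite !pi_twist // gen // => /addrI ->.
have k1 := key (-1) cN1; have k2 := key 'i%C (cmodi R).
have i2 : 'i%C * 'i%C = -1 :> C by rewrite -expr2 sqr_i.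
have : (('i%C - 1) * 2) *: (a ** b) + (('i%C - 1) * ('i%C - 1)) *: (a ** b) = 0.
  have : (-1 - 1 : C) *: (('i%C - 1) *: s) - ('i%C - 1) *: ((-1 - 1 : C) *: s) = 0 by calg.
  rewrite k1 k2 => h; apply: (@scalerI _ _ (-2 : C)); first by rewrite oppr_eq0.
  by rewrite scaler0 -[RHS]h; calg.
rewrite -scalerDl => /eqP; rewrite scaler_eq0 => /orP[|/eqP //].
have -> : ('i%C - 1) * 2 + ('i%C - 1) * ('i%C - 1) = 'i%C * 'i%C - 1 :> C by ring.
by rewrite i2 -opprD oppr_eq0 -mulr2n pnatr_eq0.
Qed.

Lemma pi_spectral_aux k (l : 'I_k -> C) (p : 'I_k -> F) (r : seq 'I_k) :
  (forall i, projection (p i)) -> (forall i j, i != j -> p i ** p j = 0) ->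
  (forall i, cmod (l i) = 1) -> uniq r ->
  U (e + \sum_(i <- r) (l i - 1) *: p i) /\
  pi (e + \sum_(i <- r) (l i - 1) *: p i) = q + \sum_(i <- r) (l i - 1) *: psi0 (p i).
Proof.
move=> pp porth l1; elim: r => [|i r IH] /=; first by rewrite !big_nil !addr0.
move=> /andP[ir /IH [ur pir]].
have [_ qq] := q_projection.
have step (B : cstarAlgType R) (f : B) (p' : 'I_k -> B) :
    f ** f = f -> (forall i, f ** p' i = p' i /\ p' i ** f = p' i) ->
    (forall i j, i != j -> p' i ** p' j = 0) ->
    twist f (l i) (p' i) ** (f + \sum_(j <- r) (l j - 1) *: p' j) =
    f + \sum_(j <- i :: r) (l j - 1) *: p' j.
  move=> ff fp p'orth; rewrite big_cons /twist cmulDl !cmulDr -!cscaleAl ff.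
  have [_ ->] := fp i.
  have -> : p' i ** (\sum_(j <- r) (l j - 1) *: p' j) = 0.
    rewrite cmul_sumr big_seq big1 // => j jr; rewrite -cscaleAr p'orth ?scaler0 //.
    by apply: contraNneq ir => ->.
  have -> : f ** (\sum_(j <- r) (l j - 1) *: p' j) = \sum_(j <- r) (l j - 1) *: p' j.
    rewrite cmul_sumr; apply: eq_bigr => j _.
    by rewrite -cscaleAr; have [-> _] := fp j.
  by rewrite scaler0 addr0 -addrA [X in _ + X]addrC.
have [_ ee] := pe.
have eE := step F e p ee (fun i => conj (mul_e_x eF _) (mul_x_e eF _)) porth.
have qE := step A q (fun i => psi0 (p i)) qq.
have ut := tU (pp i) (l1 i).
rewrite -eE -qE.
- by split; [exact: unitaryM | rewrite piM // pir pi_twist].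
- by move=> j; have [_ -> ->] := psi0_below (pp j).
- by move=> j j' jj'; apply: psi0_orth => //; exact: porth.
Qed.

Lemma pi_spectral k (l : 'I_k -> C) (p : 'I_k -> F) :
  (forall i, projection (p i)) -> (forall i j, i != j -> p i ** p j = 0) ->
  (forall i, cmod (l i) = 1) -> \sum_i p i = e ->
  pi (\sum_i l i *: p i) = q + \sum_i (l i - 1) *: psi0 (p i).
Proof.
move=> pp porth l1 sp; rewrite -(pi_spectral_aux pp porth l1 (index_enum_uniq _)).2.
congr pi; rewrite -[in RHS]sp -big_split /=; apply: eq_bigr => i _.
by rewrite scalerBl scale1r addrCA subrr addr0.
Qed.

(** The difference is a projection of norm less than one. *)
Lemma psi0_e : psi0 e = q.
Proof.
have [[ps _] qp pq'] := psi0_below pe; have [qs qq] := q_projection.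
have pd : projection (q - psi0 e).
  have [_ pp] := psi0_projection pe.
  split; first by rewrite cstarB ps qs.
  by rewrite cmulBl !cmulBr qq qp pq' pp subrr subr0.
apply/eqP; rewrite eq_sym -subr_eq0; apply: contraT => h.
have := nrm_projection pd h.
have := psi0_close pe; have := phi_pi ue.
have := nrm_tri (phi e) q (psi0 e).
rewrite (nrm_distC q (phi e)) (nrm_distC (phi e) (psi0 e)).
by rewrite -/q => k1 k2 k3 k4; have := small; have := eps0; lra.
Qed.

Lemma psi0_sum k (p : 'I_k -> F) :
  (forall i, projection (p i)) -> (forall i j, i != j -> p i ** p j = 0) ->
  \sum_i p i = e -> \sum_i psi0 (p i) = q.
Proof.
move=> pp porth sp.
have h := pi_spectral (l := fun=> -1) pp porth (fun=> cN1) sp.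
have := pi_twist pe cN1; rewrite psi0_e.
have -> : twist e (-1) e = \sum_i (-1) *: p i.
  by rewrite -scaler_sumr sp /twist; calg.
rewrite h -scaler_sumr /twist => /addrI; apply: scalerI.
by rewrite -opprD oppr_eq0 -mulr2n pnatr_eq0.
Qed.

(** Each spectral value of [w] is within [nrm (w - e)] of [1], and there are
    at most [n] of them. *)
Lemma pi_lipschitz w : U w -> nrm (pi w - q) <= n%:R * nrm (w - e).
Proof.
move=> uw; have [k [l [p [kn pp porth lw [sp wE]]]]] := unitary_spectral vF eF uw.
rewrite {1}wE pi_spectral //; last by move=> i; have [] := lw i.
rewrite addrAC subrr add0r; apply: le_trans (nrm_sum _ _ _) _.
apply: (@le_trans _ _ (\sum_(i < k) nrm (w - e))).
  apply: ler_sum => i _; rewrite nrmZ -[leRHS]mulr1.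
  apply: ler_pM; rewrite ?cmod_ge0 ?nrm_ge0 //; first by have [] := lw i.
  exact: nrm_projection_le1 (psi0_projection (pp i)).
rewrite sumr_const card_ord -[_ *+ k]mulr_natl ler_wpM2r ?nrm_ge0 //.
by rewrite ler_nat.
Qed.

(** The curve through [e] attached to the relation has no first-order term, so
    it stays within [O(x^2)] of [e] at time [x]; the same holds for its image
    under [pi], which is the curve attached to the images of the projections.
    *)
Lemma psi0_real_relation (s : seq (R * F)) :
  (forall z, z \in s -> projection z.2) -> tangent s = 0 ->
  tangent [seq (z.1, psi0 z.2) | z <- s] = 0.
Proof.
move=> sp s0; pose s' := [seq (z.1, psi0 z.2) | z <- s].
have bs z : z \in s -> below e z.2 by move=> /sp; exact: bp.
have bs' z : z \in s' -> below q z.2.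
  by move=> /mapP[w /sp pw ->]; exact: psi0_below.
have [K K0 [t0 /andP[t00 t01] h]] := curve_expand pe bs.
have [K' K'0 [t0' /andP[t00' t01'] h']] := curve_expand q_projection bs'.
pose t1 := Num.min t0 t0'.
have t1p : 0 < t1 by rewrite lt_min t00 t00'.
have t11 : t1 <= 1 by rewrite ge_min t01.
have t1t0 : t1 <= t0 by rewrite ge_min lexx.
have t1t0' : t1 <= t0' by rewrite ge_min lexx orbT.
pose N := n%:R * K + K'.
have N0 : 0 <= N by rewrite addr_ge0 ?mulr_ge0.
apply: (@nrm_small_eq0 _ _ _ N) => t tp tle.
pose x := t * t1; have xp : 0 < x by rewrite mulr_gt0.
have xt1 : x <= t1 by rewrite /x ler_piMl // ltW.
have xt : x <= t by rewrite /x ler_piMr // ltW.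
have [c1 k1] := h x xp (le_trans xt1 t1t0).
have [_ k2] := h' x xp (le_trans xt1 t1t0').
rewrite s0 scaler0 subr0 in k1.
have [ucur picur] : U (curve e x s) /\ pi (curve e x s) = curve q x s'.
  rewrite /s'; elim: (s) sp c1 => [|z r IH] sp' c1' //=.
  have rz w : w \in r -> w \in z :: r by exact: (@mem_behead _ (z :: r) w).
  have [ur pir] := IH (fun w wr => sp' w (rz w wr)) (fun w wr => c1' w (rz w wr)).
  have pz : projection z.2 by apply: sp'; rewrite mem_head.
  have cz := cmod_circle_pt (c1' z (mem_head _ _)).
  have ut := tU pz cz.
  by split; [exact: unitaryM | rewrite piM // pir pi_twist].
have k3 := pi_lipschitz ucur; rewrite picur in k3.
have k4 : nrm (('i%C * x%:C) *: tangent s') = x * nrm (tangent s').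
  by rewrite nrmZ cmodM cmodi mul1r cmodR gtr0_norm.
have k5 := nrmB (curve q x s' - q) (curve q x s' - q - ('i%C * x%:C) *: tangent s').
rewrite opprB addrC subrK k4 in k5.
have k6 : n%:R * nrm (curve e x s - e) <= n%:R * (K * x ^+ 2) by rewrite ler_wpM2l.
have k7 : x * nrm (tangent s') <= x * (N * x) by rewrite /N; lra.
rewrite ler_pM2l // in k7; apply: le_trans k7 _.
by rewrite ler_wpM2l.
Qed.

Definition combination (s : seq (C * F)) : F := \sum_(z <- s) z.1 *: z.2.
Definition image_combination (s : seq (C * F)) : A :=
  \sum_(z <- s) z.1 *: psi0 z.2.
Definition all_projections (s : seq (C * F)) :=
  forall z, z \in s -> projection z.2.

(** Taking adjoints, the conjugate coefficients satisfy the same relation;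
    hence so do their real and imaginary parts. *)
Lemma psi0_relation s : all_projections s -> combination s = 0 ->
  image_combination s = 0.
Proof.
move=> sp s0.
pose re := [seq (complex.Re z.1, z.2) | z <- s].
pose im := [seq (complex.Im z.1, z.2) | z <- s].
have cs0 : \sum_(z <- s) Num.conj z.1 *: z.2 = 0.
  transitivity (cstar (combination s)); last by rewrite s0 cstar0.
  rewrite /combination cstar_sum big_seq [RHS]big_seq.
  by apply: eq_bigr => z /sp[ps _]; rewrite cstarZ ps.
have two0 : (2 : C) != 0 by rewrite pnatr_eq0.
have reE (z : C) : (complex.Re z)%:C = 2^-1 * (z + Num.conj z).
  apply: (mulfI two0); rewrite [RHS]mulrA divff // mul1r.
  by case: z => a b; apply/eqP; rewrite eq_complex /=; apply/andP; split; apply/eqP; lra.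
have imE (z : C) : (complex.Im z)%:C = (2^-1 * - 'i%C) * (z - Num.conj z).
  apply: (mulfI two0); rewrite [RHS]mulrA [2 * (2^-1 * _)]mulrA divff // mul1r.
  by case: z => a b; apply/eqP; rewrite eq_complex /=; apply/andP; split; apply/eqP; lra.
have re0 : tangent re = 0.
  rewrite /tangent big_map /=; under eq_bigr => z _ do rewrite reE -scalerA scalerDl.
  by rewrite -scaler_sumr big_split /= [X in X + _]s0 cs0 addr0 scaler0.
have im0 : tangent im = 0.
  rewrite /tangent big_map /=; under eq_bigr => z _ do rewrite imE -scalerA scalerBl.
  by rewrite -scaler_sumr sumrB /= [X in X - _]s0 cs0 subr0 scaler0.
have pre z : z \in re -> projection z.2 by move=> /mapP[w /sp pw ->].
have pim z : z \in im -> projection z.2 by move=> /mapP[w /sp pw ->].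
have := psi0_real_relation pre re0; have := psi0_real_relation pim im0.
rewrite /tangent !big_map /= => im1 re1.
rewrite /image_combination.
transitivity (\sum_(z <- s) (complex.Re z.1)%:C *: psi0 z.2 +
    'i%C *: \sum_(z <- s) (complex.Im z.1)%:C *: psi0 z.2).
  rewrite scaler_sumr -big_split; apply: eq_bigr => z _.
  by rewrite /= scalerA -scalerDl -complexE.
by rewrite im1 re1 scaler0 addr0.
Qed.

Lemma combination_cat s1 s2 :
  combination (s1 ++ s2) = combination s1 + combination s2.
Proof. by rewrite /combination big_cat. Qed.

Lemma image_combination_cat s1 s2 :
  image_combination (s1 ++ s2) = image_combination s1 + image_combination s2.
Proof. by rewrite /image_combination big_cat. Qed.

Definition scale_combination (a : C) (s : seq (C * F)) :=
  [seq (a * z.1, z.2) | z <- s].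

Lemma combination_scale a s :
  combination (scale_combination a s) = a *: combination s.
Proof.
rewrite /combination big_map scaler_sumr; apply: eq_bigr => z _.
by rewrite scalerA.
Qed.

Lemma image_combination_scale a s :
  image_combination (scale_combination a s) = a *: image_combination s.
Proof.
rewrite /image_combination big_map scaler_sumr; apply: eq_bigr => z _.
by rewrite scalerA.
Qed.

Lemma all_projections_cat s1 s2 : all_projections s1 -> all_projections s2 ->
  all_projections (s1 ++ s2).
Proof. by move=> h1 h2 z; rewrite mem_cat => /orP[/h1|/h2]. Qed.

Lemma all_projections_scale a s : all_projections s ->
  all_projections (scale_combination a s).
Proof. by move=> h z /mapP[w /h pw ->]. Qed.

Lemma unitary_combination u : U u -> exists s, [/\ all_projections s,
  combination s = u & image_combination s = pi u].
Proof.
move=> uu; have [k [l [p [_ pp porth lu [sp uE]]]]] := unitary_spectral vF eF uu.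
exists [seq (l i, p i) | i <- index_enum 'I_k]; split.
- by move=> z /mapP[i _ ->]; exact: pp.
- by rewrite /combination big_map uE.
rewrite /image_combination big_map /= {1}uE pi_spectral //; last first.
  by move=> i; have [] := lu i.
rewrite -(psi0_sum pp porth sp) -big_split /=; apply: eq_bigr => i _.
by rewrite scalerBl scale1r addrCA subrr addr0.
Qed.

Lemma combination_exists x : exists s, all_projections s /\ combination s = x.
Proof.
elim/(unitary_ind vF eF): x => [u /unitary_combination [s [h1 h2 _]]|x y|a x].
- by exists s.
- move=> [s [h1 <-]] [s' [h1' <-]]; exists (s ++ s').
  by split; [exact: all_projections_cat | exact: combination_cat].
- move=> [s [h1 <-]]; exists (scale_combination a s).
  by split; [exact: all_projections_scale | exact: combination_scale].
Qed.

(** Every element is a combination of projections, and relations between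
    projections are respected, so the image is independent of the chosen
    combination. Multiplicativity is checked on unitaries, which span. *)
Theorem linear_extension : exists2 psi : F -> A, star_homomorphism psi &
  forall u, U u -> psi u = pi u.
Proof.
have /choice[rep repP] := combination_exists.
pose psi x := image_combination (rep x).
have psiE s : all_projections s -> psi (combination s) = image_combination s.
  move=> sp; have [rp rE] := repP (combination s).
  pose d := rep (combination s) ++ scale_combination (-1) s.
  have dp : all_projections d.
    by apply: all_projections_cat => //; exact: all_projections_scale.
  apply/subr0_eq; rewrite -scaleN1r -image_combination_scale.
  rewrite -image_combination_cat; apply: psi0_relation => //.
  by rewrite combination_cat combination_scale rE scaleN1r subrr.
have psiD x y : psi (x + y) = psi x + psi y.
  have [xp xE] := repP x; have [yp yE] := repP y.
  rewrite -{1}xE -{1}yE -combination_cat psiE ?image_combination_cat //.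
  exact: all_projections_cat.
have psiZ a x : psi (a *: x) = a *: psi x.
  have [xp xE] := repP x.
  rewrite -{1}xE -combination_scale psiE ?image_combination_scale //.
  exact: all_projections_scale.
have psiU u : U u -> psi u = pi u.
  by move=> /unitary_combination [s [sp <- <-]]; exact: psiE.
exists psi => //; split.
- by move=> a x y; rewrite psiD psiZ.
- move=> x y; elim/(unitary_ind vF eF): x => [u uu|x x' hx hx'|a x hx]; last 2 first.
  + by rewrite cmulDl !psiD hx hx' cmulDl.
  + by rewrite -cscaleAl !psiZ hx cscaleAl.
  elim/(unitary_ind vF eF): y => [v uv|y y' hy hy'|a y hy].
  + by rewrite !psiU //; [exact: piM | exact: unitaryM].
  + by rewrite cmulDr !psiD hy hy' cmulDr.
  + by rewrite -cscaleAr !psiZ hy cscaleAr.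
- move=> x; elim/(unitary_ind vF eF): x => [u uu|x x' hx hx'|a x hx].
  + by rewrite !psiU ?piS //; exact: unitary_star.
  + by rewrite cstarD !psiD hx hx' cstarD.
  + by rewrite cstarZ !psiZ hx cstarZ.
Qed.

Theorem extension_close (psi : F -> A) : star_homomorphism psi ->
  (forall u, U u -> psi u = pi u) ->
  forall x, nrm x <= 1 -> nrm (psi x - phi x) <= 2 * kappa + 8 * eps.
Proof.
move=> [psiL _ _] psiU.
pose fl : {linear F -> A} := HB.pack psi (GRing.isLinear.Build _ _ _ _ psi psiL).
have psiD x y : psi (x + y) = psi x + psi y by rewrite -[psi]/(fl : F -> A) linearD.
have psiZ a x : psi (a *: x) = a *: psi x by rewrite -[psi]/(fl : F -> A) linearZ.
have half := cmod_half R.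
have half1 : cmod (2^-1 : C) <= 1 by rewrite half; lra.
have closeU u : U u -> nrm (2^-1 *: psi u - phi (2^-1 *: u)) <= 2^-1 * kappa + eps.
  move=> uu; rewrite psiU //.
  have -> : 2^-1 *: pi u - phi (2^-1 *: u) =
      - (2^-1 *: (phi u - pi u)) - (phi (2^-1 *: u) - 2^-1 *: phi u) by calg.
  have := phiZ_le phiP (n1 uu) half1; have := phi_pi uu.
  have := nrmB (- (2^-1 *: (phi u - pi u))) (phi (2^-1 *: u) - 2^-1 *: phi u).
  by rewrite nrmN nrmZ half; lra.
have closeS a : cstar a = a -> nrm a <= 1 -> nrm (psi a - phi a) <= kappa + 3 * eps.
  move=> sa a1; have [u uu ->] := selfadjoint_unitary vF eF sa a1.
  have us := unitary_star uu.
  have nh v : U v -> nrm (2^-1 *: v) <= 1.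
    by move=> uv; rewrite nrmZ half; have := n1 uv; lra.
  have k := phiD_le phiP (nh u uu) (nh _ us); rewrite -scalerDr in k.
  rewrite psiZ psiD.
  have -> : 2^-1 *: (psi u + psi (cstar u)) - phi (2^-1 *: (u + cstar u)) =
     (2^-1 *: psi u - phi (2^-1 *: u)) + (2^-1 *: psi (cstar u) - phi (2^-1 *: cstar u))
     - (phi (2^-1 *: (u + cstar u)) - phi (2^-1 *: u) - phi (2^-1 *: cstar u)) by calg.
  set a1' := _ - phi (2^-1 *: u); set a2' := _ - phi (2^-1 *: cstar u).
  have := closeU u uu; have := closeU _ us; rewrite -/a1' -/a2'.
  set a3' := _ - _ - _ in k *.
  have := nrmB (a1' + a2') a3'; have := nrmD a1' a2'; lra.
move=> x x1; have [a [b [sa sb na nb ->]]] := cartesian_decomposition x.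
have a1 := le_trans na x1; have b1 := le_trans nb x1.
have ib1 : nrm ('i%C *: b) <= 1 by rewrite nrmZ cmodi mul1r.
have k1 := phiD_le phiP a1 ib1.
have ci : cmod ('i%C : C) <= 1 by rewrite cmodi.
have k2 := phiZ_le phiP b1 ci.
have k3 := closeS a sa a1; have k4 := closeS b sb b1.
rewrite psiD psiZ.
have -> : psi a + 'i%C *: psi b - phi (a + 'i%C *: b) = (psi a - phi a)
   + 'i%C *: (psi b - phi b) - (phi (a + 'i%C *: b) - phi a - phi ('i%C *: b))
   - (phi ('i%C *: b) - 'i%C *: phi b) by calg.
have k5 : nrm ('i%C *: (psi b - phi b)) <= kappa + 3 * eps by rewrite nrmZ cmodi mul1r.
set x1' := psi a - phi a in k3 *; set x2 := 'i%C *: (psi b - _) in k5 *.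
set x3 := phi (a + _) - _ - _ in k1 *; set x4 := phi ('i%C *: b) - 'i%C *: _ in k2 *.
have := nrmB (x1' + x2 - x3) x4; have := nrmB (x1' + x2) x3; have := nrmD x1' x2.
lra.
Qed.

End Extension.

(** * Stability *)

Theorem linear_stability (R : realType) (F A : cstarAlgType R) (eps : R)
    (phi : F -> A) : 0 < eps -> 1000 * (1000 * eps) <= 1 ->
  finite_dimensional F -> approx_star_homomorphism eps phi ->
  exists2 psi : F -> A, star_homomorphism psi &
    forall x, nrm x <= 1 -> nrm (psi x - phi x) <= 22 * (1000 * eps).
Proof.
move=> e0 e6 [n vF] phiP; have [e eF] := unit_exists vF.
have e1 : eps <= 1 by lra.
have [pi pi_close [piM piS]] := near_unitary_rep phiP e0 e1 vF eF e6.
have small : 4 * (100 * (106 * eps)) + 8 * eps <= 1 / 2 by lra.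
have [psi hpsi psiU] := linear_extension phiP vF eF pi_close piM piS e0 small.
exists psi => // x x1.
have := extension_close phiP vF eF pi_close hpsi psiU x1; lra.
Qed.

Lemma map_norm_le (R : realType) (F A : cstarAlgType R) (f : F -> A) (b : R) :
  (forall x, nrm x <= 1 -> nrm (f x) <= b) -> (map_norm f <= b%:E)%E.
Proof.
move=> fb; apply: ge_ereal_sup => _ [x /= x1 <-]; rewrite lee_fin.
by apply: fb; rewrite -lecR -nrmE.
Qed.

Lemma map_norm_subC (R : realType) (F A : cstarAlgType R) (f g : F -> A) :
  map_norm (f \- g) = map_norm (g \- f).
Proof.
by congr (ereal_sup _); apply: eq_imagel => x _ /=; rewrite -normrN opprB.
Qed.

Theorem theorem1p7 (R : realType) :
  (exists K delta : R, [/\ 0 < K, 0 < delta &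
     forall eps : R, 0 < eps < delta ->
     forall F : cstarAlgType R, finite_dimensional F ->
     forall A : cstarAlgType R,
     forall phi : F -> A, approx_star_homomorphism eps phi ->
     exists2 psi : F -> A, star_homomorphism psi &
       (map_norm (psi \- phi)%R < (K * Num.sqrt eps)%R%:E)%E])
  /\ ulam_stable (@finite_dimensional R) (fun _ : cstarAlgType R => True).
Proof.
(* The constants are kept abstract so that their numerals are never unfolded.
    *)
have [K [K0 KE]] : exists K : R, 0 < K /\ K = 23 * 1000.
  by exists (23 * 1000); rewrite mulr_gt0 ?ltr0n.
have [D [D0 DE]] : exists D : R, 0 < D /\ 1000 * (1000 * D) = 1.
  have n0 : 1000 != 0 :> R by rewrite pnatr_eq0.
  exists (1000^-1 * 1000^-1); rewrite mulr_gt0 ?invr_gt0 ?ltr0n //.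
  by rewrite mulVKf // mulfV.
have main (eps : R) : 0 < eps < D ->
    forall F : cstarAlgType R, finite_dimensional F ->
    forall (A : cstarAlgType R) (phi : F -> A),
    approx_star_homomorphism eps phi ->
    exists2 psi : F -> A, star_homomorphism psi &
      (map_norm (psi \- phi)%R < (K * Num.sqrt eps)%R%:E)%E.
  move=> /andP[e0 eD] F fF A phi phiP.
  have e6 : 1000 * (1000 * eps) <= 1 by lra.
  have [psi hpsi psi_close] := linear_stability e0 e6 fF phiP.
  exists psi => //; apply: le_lt_trans (map_norm_le psi_close) _.
  rewrite lte_fin; set s := Num.sqrt eps.
  have s0 : 0 < s by rewrite sqrtr_gt0.
  have ss : s * s = eps by rewrite -expr2 sqr_sqrtr // ltW.
  have e1 : eps <= 1 by lra.
  have s1 : s <= 1 by rewrite /s -sqrtr1 ler_sqrt.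
  have es : eps <= s by rewrite -ss ler_piMr // ltW.
  rewrite KE; lra.
split; first by exists K, D; split=> // eps he F fF A; exact: main.
move=> eps eps0.
pose c := eps / K; pose d := Num.min (D / 2) (c ^+ 2).
have c0 : 0 < c by rewrite divr_gt0.
have d0 : 0 < d by rewrite lt_min exprn_gt0 // divr_gt0.
exists d => // F A fF _ phi phiP.
have dD : 0 < d < D.
  by rewrite d0 gt_min ltr_pdivrMr // mulr_natr mulr2n ltrDl D0.
have [psi hpsi h] := main d dD F fF A phi phiP.
exists psi => //; rewrite map_norm_subC; apply: lt_le_trans h _.
rewrite lee_fin -ler_pdivlMl // mulrC -/c.
rewrite -(ger0_norm (ltW c0)) -sqrtr_sqr ler_sqrt ?sqr_ge0 //.
by rewrite ge_min lexx orbT.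
Qed.
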